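(* Consider a port-Hamiltonian descriptor system $(E,J,R,Q,B)$ with $A=(J-R)Q$, $C=B^\top Q$, such that $(E,A)$ is regular, $(E,A,B)$ is strongly stabilizable and $(E,A,C)$ is strongly detectable. Then: (i) there exist stabilizing solutions of (GC) and of (GF); (ii) any two stabilizing solutions $\mathcal P_{\mathrm c,1},\mathcal P_{\mathrm c,2}$ of (GC) satisfy $E^\top\mathcal P_{\mathrm c,1}=E^\top\mathcal P_{\mathrm c,2}$, and any two stabilizing solutions $\mathcal P_{\mathrm f,1},\mathcal P_{\mathrm f,2}$ of (GF) satisfy $E\mathcal P_{\mathrm f,1}^\top=E\mathcal P_{\mathrm f,2}^\top$; (iii) if $Q$ is invertible, then $Q^{-\top}$ is a stabilizing solution of (GF); (iv) there exist stabilizing solutions $\mathcal P_{\mathrm c}$ of (GC) and $\mathcal P_{\mathrm f}$ of (GF) such that $I_n+\mathcal P_{\mathrm f}\mathcal P_{\mathrm c}^\top$ is invertible.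
   Context: A pH descriptor system: $E,J,R,Q\in\mathbb{R}^{n\times n}$, $B\in\mathbb{R}^{n\times m}$, $E^\top Q=Q^\top E\succeq0$, $J^\top=-J$, $R=R^\top\succeq0$, $A:=(J-R)Q$, $C:=B^\top Q$. A pencil $(E,A)$ is regular if $\det(sE-A)\ne0$ for some $s\in\mathbb{C}$; finite eigenvalues are $\lambda$ with $\lambda Ev=Av$, $v\ne0$; a regular pencil is impulse-free if in its Weierstraß form $P^{-1}E\widetilde P=\mathrm{diag}(I,N)$, $P^{-1}A\widetilde P=\mathrm{diag}(W,I)$ ($N$ nilpotent, $P,\widetilde P$ invertible) one has $N=0$. For regular $(E,A)$, $(E,A,B)$ is impulse controllable if $\mathrm{rank}[E\ \ AS\ \ B]=n$ with $\mathrm{im}\,S=\ker E$; strongly stabilizable if impulse controllable and $\mathrm{rank}[\lambda E-A\ \ B]=n$ for all $\mathrm{Re}\,\lambda\ge0$; $(E,A,C)$ is strongly detectable if $(E^\top,A^\top,C^\top)$ is strongly stabilizable. Modified GAREs: (GC) $A^\top\mathcal P_{\mathrm c}+\mathcal P_{\mathrm c}^\top A-\mathcal P_{\mathrm c}^\top BB^\top\mathcal P_{\mathrm c}+C^\top C=0$, $E^\top\mathcal P_{\mathrm c}=\mathcal P_{\mathrm c}^\top E$; (GF) $A\mathcal P_{\mathrm f}^\top+\mathcal P_{\mathrm f}A^\top-\mathcal P_{\mathrm f}C^\top C\mathcal P_{\mathrm f}^\top+BB^\top+2R=0$, $E\mathcal P_{\mathrm f}^\top=\mathcal P_{\mathrm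 f}E^\top$. A solution $\mathcal P_{\mathrm c}$ is stabilizing if $(E,A-BB^\top\mathcal P_{\mathrm c})$ is regular, impulse-free with all finite eigenvalues in the open left half-plane; $\mathcal P_{\mathrm f}$ is stabilizing if $(E,A-\mathcal P_{\mathrm f}C^\top C)$ is. *)

(* Defs.v *)
From HB Require Import structures.
From mathcomp Require Export all_boot all_order all_algebra.
From mathcomp Require Export reals.
From mathcomp Require Export complex.
Set Implicit Arguments. Unset Strict Implicit. Unset Printing Implicit Defensive.
Import Order.TTheory GRing.Theory Num.Theory.
Local Open Scope ring_scope.

Section Defs.
Variable R : realType.

Definition cmx {p q : nat} (M : 'M[R]_(p, q)) : 'M[R[i]]_(p, q) :=
  map_mx (fun x : R => (x%:C)%C) M.

(* positive semidefinite (the matrix is assumed/required symmetric separately) *)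
Definition psd {n : nat} (M : 'M[R]_n) : Prop :=
  forall x : 'cV[R]_n, 0 <= (x^T *m M *m x) 0 0.

Definition regular_pencil {n : nat} (E A : 'M[R]_n) : Prop :=
  exists s : R[i], \det (s *: cmx E - cmx A) != 0.

Definition finite_eigenvalue {n : nat} (E A : 'M[R]_n) (l : R[i]) : Prop :=
  exists v : 'cV[R[i]]_n, v != 0 /\ l *: (cmx E *m v) = cmx A *m v.

Definition nilpotent_mx {k : nat} (N : 'M[R]_k) : Prop := exists p : nat, N ^+ p = 0.

Definition weierstrass_form {n : nat} (E A : 'M[R]_n) (r k : nat) (H : r + k = n)
  (P Pt : 'M[R]_n) (W : 'M[R]_r) (N : 'M[R]_k) : Prop :=
  [/\ P \in unitmx, Pt \in unitmx, nilpotent_mx N,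
      invmx P *m E *m Pt = castmx (H, H) (block_mx 1%:M 0 0 N) &
      invmx P *m A *m Pt = castmx (H, H) (block_mx W 0 0 1%:M)].

Definition impulse_free {n : nat} (E A : 'M[R]_n) : Prop :=
  exists (r k : nat) (H : r + k = n) (P Pt : 'M[R]_n) (W : 'M[R]_r) (N : 'M[R]_k),
    weierstrass_form E A H P Pt W N /\ N = 0.

Definition stable_pencil {n : nat} (E A : 'M[R]_n) : Prop :=
  [/\ regular_pencil E A, impulse_free E A &
      forall l : R[i], finite_eigenvalue E A l -> complex.Re l < 0].

Definition impulse_controllable {n m : nat} (E A : 'M[R]_n) (B : 'M[R]_(n, m)) : Prop :=
  exists (k : nat) (S : 'M[R]_(n, k)),
    (S^T :=: kermx E^T)%MS /\ \rank (row_mx E (row_mx (A *m S) B)) = n.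

Definition strongly_stabilizable {n m : nat} (E A : 'M[R]_n) (B : 'M[R]_(n, m)) : Prop :=
  impulse_controllable E A B /\
  forall l : R[i], 0 <= complex.Re l ->
    \rank (row_mx (l *: cmx E - cmx A) (cmx B)) = n.

Definition strongly_detectable {n m : nat} (E A : 'M[R]_n) (C : 'M[R]_(m, n)) : Prop :=
  strongly_stabilizable E^T A^T C^T.

Definition GC {n m : nat} (E A : 'M[R]_n) (B : 'M[R]_(n, m)) (C : 'M[R]_(m, n))
  (Pc : 'M[R]_n) : Prop :=
  A^T *m Pc + Pc^T *m A - Pc^T *m B *m B^T *m Pc + C^T *m C = 0 /\
  E^T *m Pc = Pc^T *m E.

Definition GF {n m : nat} (E A Rm : 'M[R]_n) (B : 'M[R]_(n, m)) (C : 'M[R]_(m, n))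
  (Pf : 'M[R]_n) : Prop :=
  A *m Pf^T + Pf *m A^T - Pf *m C^T *m C *m Pf^T + B *m B^T + 2%:R *: Rm = 0 /\
  E *m Pf^T = Pf *m E^T.

Definition stabilizing_GC {n m : nat} (E A : 'M[R]_n) (B : 'M[R]_(n, m))
  (C : 'M[R]_(m, n)) (Pc : 'M[R]_n) : Prop :=
  GC E A B C Pc /\ stable_pencil E (A - B *m B^T *m Pc).

Definition stabilizing_GF {n m : nat} (E A Rm : 'M[R]_n) (B : 'M[R]_(n, m))
  (C : 'M[R]_(m, n)) (Pf : 'M[R]_n) : Prop :=
  GF E A Rm B C Pf /\ stable_pencil E (A - Pf *m C^T *m C).

End Defs.

(* Main.v *)
Require Import Defs.
From mathcomp Require Import all_boot all_order all_algebra reals complex.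
From mathcomp Require Import ring lra zify.
Import Order.TTheory GRing.Theory Num.Theory.
Local Open Scope ring_scope.
Set Implicit Arguments. Unset Strict Implicit. Unset Printing Implicit Defensive.

(** The filter equation for [Pf] is the control equation of the transposed system
in the unknown [Pf^T], so both are instances of
[A^T P + P^T A - P^T G P + W = 0], [E^T P = P^T E] with [G], [W] positive semidefinite.

Existence: after independent changes of basis on both sides, [E = diag(I, 0)]
and the lower right block of [A] is [- diag(I, 0)].  The lower right block of
the equation is then an ordinary Riccati equation; shifting by its stabilizing
solution makes the lower right block of [A] invertible, and block elimination
leaves one more ordinary Riccati equation.  The weight of the latter need not be
semidefinite, but its Hamiltonian matrix has no imaginary eigenvalues because
the original pencil has none; its stable invariant subspace is the graph of the
stabilizing solution.

Uniqueness is a Sylvester equation between the two closed loops.  For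
the invertibility of [1 + Pf Pc^T], comparing both Riccati equations on
[x \in ker (1 + Pf^T Pc)] shows that [R Pc x = 0], that the control closed loop
maps this kernel into [ker (1 + Pf Pc^T)], and that [Pc x] carries a stable
eigenvalue of the control closed loop over to an unstable one of the filter
closed loop. *)

(** * Abelian group identities by reflection *)

Inductive zmod_expr := ZAtom of nat | ZZero | ZAdd of zmod_expr & zmod_expr | ZOpp of zmod_expr.

Fixpoint zmod_eval (V : zmodType) (s : seq V) e : V := match e with
  | ZAtom i => s`_i
  | ZZero => 0
  | ZAdd e1 e2 => zmod_eval s e1 + zmod_eval s e2
  | ZOpp e1 => - zmod_eval s e1
  end.

Fixpoint zmod_coef e (i : nat) : int := match e with
  | ZAtom j => (j == i)%:R
  | ZZero => 0
  | ZAdd e1 e2 => zmod_coef e1 i + zmod_coef e2 i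
  | ZOpp e1 => - zmod_coef e1 i
  end.

Lemma zmod_evalE (V : zmodType) (s : seq V) e :
  zmod_eval s e = \sum_(i < size s) s`_i *~ zmod_coef e i.
Proof.
elim: e => [j||e1 IH1 e2 IH2|e IH] /=.
- have [js|sj] := ltnP j (size s).
    rewrite (bigD1 (Ordinal js)) //= eqxx mulr1z big1 ?addr0 // => i.
    by rewrite -val_eqE eq_sym /= => /negPf->; rewrite mulr0z.
  rewrite nth_default // big1 // => i _.
  by rewrite gtn_eqF ?mulr0z // (leq_trans (ltn_ord i)).
- by rewrite big1 // => i _; rewrite mulr0z.
- by rewrite IH1 IH2 -big_split; apply: eq_bigr => i _; rewrite mulrzDr.
- by rewrite IH -sumrN; apply: eq_bigr => i _; rewrite mulrNz.
Qed.

Lemma zmod_eval_eq (V : zmodType) (s : seq V) e1 e2 :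
    all (fun i => zmod_coef e1 i == zmod_coef e2 i) (iota 0 (size s)) ->
  zmod_eval s e1 = zmod_eval s e2.
Proof.
move=> /allP h; rewrite !zmod_evalE; apply: eq_bigr => i _; congr (_ *~ _).
by apply/eqP/h; rewrite mem_iota /=.
Qed.

Ltac zmod_atoms t l := lazymatch t with
  | (?a + ?b)%R => let l1 := zmod_atoms a l in zmod_atoms b l1
  | (- ?a)%R => zmod_atoms a l
  | 0%R => l
  | _ => let rec mem l' := lazymatch l' with
           | t :: _ => l | _ :: ?l'' => mem l'' | _ => constr:(t :: l) end in mem l
  end.
Ltac zmod_reify t l := lazymatch t with
  | (?a + ?b)%R => let x := zmod_reify a l in let y := zmod_reify b l in constr:(ZAdd x y)
  | (- ?a)%R => let x := zmod_reify a l in constr:(ZOpp x)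
  | 0%R => constr:(ZZero)
  | _ => let rec idx l' := lazymatch l' with
           | t :: _ => constr:(O) | _ :: ?l'' => let i := idx l'' in constr:(S i) end in
         let i := idx l in constr:(ZAtom i)
  end.
(** Matrix products are first generalized to atoms, so that only an additive identity is left;
    comparing integer coefficients atom by atom then decides it by computation. *)
Ltac zmod_abel :=
  repeat match goal with |- context [?A *m ?B] =>
    let Z := fresh "Z" in set Z := (A *m B); clearbody Z end;
  lazymatch goal with |- @eq ?T ?a ?b =>
  let l0 := constr:(@nil T) in
  let l1 := zmod_atoms a l0 in let l := zmod_atoms b l1 in
  let x := zmod_reify a l in let y := zmod_reify b l in
  let H := fresh "H" in
  have H := @zmod_eval_eq _ l x y isT; simpl in H; exact H end.

(** * Hurwitz matrices and the Sylvester equation *)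

Section Complex.
Variable R : realType.
Local Notation C := R[i].
Local Open Scope sesquilinear_scope.
Implicit Types z l s : C.

Lemma complexReN z : complex.Re (- z) = - complex.Re z. Proof. by case: z. Qed.
Lemma complexRe_conj z : complex.Re z^* = complex.Re z. Proof. by case: z. Qed.
Lemma conj_Re0 z : complex.Re z = 0 -> z^* = - z.
Proof. by case: z => a b /= ->; congr Complex; rewrite oppr0. Qed.

Lemma conjNK z : (- z^*)^* = - z.
Proof. by case: z => a b; congr Complex; rewrite opprK. Qed.

Lemma trmxC_mul m n p (A : 'M[C]_(m, n)) (B : 'M[C]_(n, p)) :
  (A *m B)^t* = B^t* *m A^t*.
Proof. by rewrite trmx_mul map_mxM. Qed.
Lemma trmxCK m n (A : 'M[C]_(m, n)) : (A^t*)^t* = A.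
Proof. by apply/matrixP=> i j; rewrite !mxE conjCK. Qed.
Lemma trmxCD m n (A B : 'M[C]_(m, n)) : (A + B)^t* = A^t* + B^t*.
Proof. by rewrite linearD map_mxD. Qed.
Lemma trmxCN m n (A : 'M[C]_(m, n)) : (- A)^t* = - A^t*.
Proof. by rewrite linearN map_mxN. Qed.
Lemma trmxCB m n (A B : 'M[C]_(m, n)) : (A - B)^t* = A^t* - B^t*.
Proof. by rewrite trmxCD trmxCN. Qed.
Lemma trmxCZ m n z (A : 'M[C]_(m, n)) : (z *: A)^t* = z^* *: A^t*.
Proof. by rewrite linearZ map_mxZ. Qed.
Lemma trmxC_scalar n z : (z%:M : 'M[C]_n)^t* = (z^*)%:M.
Proof. by rewrite tr_scalar_mx map_scalar_mx. Qed.
Lemma trmxC0 m n : (0 : 'M[C]_(m, n))^t* = 0.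
Proof. by rewrite trmx0 map_mx0. Qed.
Lemma unitmx_trC n (A : 'M[C]_n) : (A^t* \in unitmx) = (A \in unitmx).
Proof. by rewrite map_unitmx unitmx_tr. Qed.

Lemma trmxC_block m1 m2 n1 n2 (a : 'M[C]_(m1, n1)) (b : 'M[C]_(m1, n2))
    (c : 'M[C]_(m2, n1)) (d : 'M[C]_(m2, n2)) :
  (block_mx a b c d : 'M[C]_(m1 + m2, n1 + n2))^t* = block_mx (a^t*) (c^t*) (b^t*) (d^t*).
Proof. by rewrite tr_block_mx map_block_mx. Qed.

Lemma unitmx_mul0 n (M : 'M[C]_n) : M \in unitmx -> forall p (v : 'M_(n, p)), M *m v = 0 -> v = 0.
Proof. by move=> Mu p v e; rewrite -[v](mulKmx Mu) e mulmx0. Qed.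

Lemma nonunit_ker n (M : 'M[C]_n) :
  M \notin unitmx -> exists2 v : 'cV_n, v != 0 & M *m v = 0.
Proof.
rewrite -unitmx_tr -row_free_unit -kermx_eq0 => /rowV0Pn[v /sub_kermxP e v0].
by exists v^T; rewrite ?trmx_eq0 // -[M]trmxK -trmx_mul e trmx0.
Qed.

(** The spectrum lies in the open left half-plane. Phrasing this as invertibility lets it pass
    directly to adjoints and similar matrices. *)
Definition hurwitz n (L : 'M[C]_n) := forall l, 0 <= complex.Re l -> l%:M - L \in unitmx.

Lemma hurwitz_eig n (L : 'M[C]_n) :
  (forall l (v : 'cV_n), 0 <= complex.Re l -> L *m v = l *: v -> v = 0) -> hurwitz L.
Proof.
move=> h l hl; case: (boolP (_ \in unitmx)) => // /nonunit_ker[v /eqP v0].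
rewrite mulmxBl mul_scalar_mx => e; case: v0; apply: (h l) => //.
by apply/esym/eqP; rewrite -subr_eq0 e.
Qed.

Lemma eig_hurwitz n (L : 'M[C]_n) l (v : 'cV_n) :
  hurwitz L -> 0 <= complex.Re l -> L *m v = l *: v -> v = 0.
Proof.
move=> h hl e; apply: (unitmx_mul0 (h l hl)).
by rewrite mulmxBl mul_scalar_mx e subrr.
Qed.

(** The rows of [Z] form a basis of the invariant subspace and [D] is the matrix of the restricted
    map, which has an eigenvector because the field is algebraically closed. *)
Lemma eigenvector_in_kernel p n (K : 'M[C]_(p, n)) (L : 'M[C]_n) (x0 : 'cV_n) :
    (forall x : 'cV_n, K *m x = 0 -> K *m (L *m x) = 0) -> K *m x0 = 0 -> x0 != 0 ->
  exists l (x : 'cV_n), [/\ x != 0, K *m x = 0 & L *m x = l *: x].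
Proof.
move=> inv e0 n0.
pose Z := row_base (kermx K^T).
have rf : row_free Z by exact: row_base_free.
have Zx (w : 'rV_n) : (w <= Z)%MS = (w *m K^T == 0).
  by rewrite eq_row_base; apply/sub_kermxP/eqP.
have ZL : (Z *m L^T <= Z)%MS.
  apply/row_subP=> i; rewrite Zx row_mul.
  have /eqP : row i Z *m K^T == 0 by rewrite -Zx row_sub.
  move/(congr1 trmx); rewrite trmx_mul trmxK trmx0 => /inv.
  by move/(congr1 trmx); rewrite !trmx_mul trmxK trmx0 => ->.
have [D eD] := submxP ZL.
have d0 : (0 < \rank (kermx K^T))%N.
  rewrite lt0n mxrank_eq0; apply/rowV0Pn; exists x0^T; last by rewrite trmx_eq0.
  by apply/sub_kermxP; rewrite -trmx_mul e0 trmx0.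
have [l /eigenvalueP[v ev v0]] := eigenvalue_closed D d0.
exists l, (v *m Z)^T; split.
- rewrite trmx_eq0; apply: contra v0 => /eqP e; apply/eqP.
  by apply: (row_free_inj rf); rewrite e mul0mx.
- have /eqP : (v *m Z) *m K^T == 0 by rewrite -Zx submxMl.
  by move/(congr1 trmx); rewrite trmx_mul trmxK trmx0.
- by rewrite -[L]trmxK -trmx_mul -mulmxA eD mulmxA ev -scalemxAl linearZ.
Qed.

(** The monic polynomial with root list [ss], evaluated at [M]; as a product of linear factors it
    supports induction on the list of roots. *)
Definition rootprod n (ss : seq C) (M : 'M[C]_n) : 'M[C]_n :=
  foldr (fun s X => (M - s%:M) *m X) 1%:M ss.

Lemma rootprod_intertwine n p ss (M : 'M[C]_n) (V : 'M_(n, p)) (L : 'M_p) :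
  M *m V = V *m L -> rootprod ss M *m V = V *m rootprod ss L.
Proof.
move=> e; elim: ss => [|s ss IH] /=; first by rewrite mul1mx mulmx1.
by rewrite -mulmxA IH !mulmxA mulmxBl mulmxBr e mul_scalar_mx mul_mx_scalar.
Qed.

Lemma rootprod_eig n ss (M : 'M[C]_n) (v : 'cV_n) l :
  M *m v = l *: v -> rootprod ss M *m v = (\prod_(s <- ss) (l - s)) *: v.
Proof.
move=> e; elim: ss => [|s ss IH] /=; first by rewrite mul1mx big_nil scale1r.
by rewrite big_cons -mulmxA IH -scalemxAr mulmxBl e mul_scalar_mx -scalerBl scalerA mulrC.
Qed.

Lemma rootprod_unit n ss (M : 'M[C]_n) :
  (forall s, s \in ss -> M - s%:M \in unitmx) -> rootprod ss M \in unitmx.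
Proof.
elim: ss => [|s ss IH] h /=; first by rewrite unitmx1.
rewrite unitmx_mul; apply/andP; split; first exact/h/mem_head.
by apply: IH => t ht; apply: h; rewrite in_cons ht orbT.
Qed.

Lemma rootprod_horner n ss (M : 'M[C]_n.+1) :
  rootprod ss M = horner_mx M (\prod_(s <- ss) ('X - s%:P)).
Proof.
elim: ss => [|s ss IH] /=; first by rewrite big_nil -polyC1 horner_mx_C.
by rewrite big_cons rmorphM rmorphB /= horner_mx_X horner_mx_C IH.
Qed.

Lemma rootprod_annihilates n (M : 'M[C]_n) :
  exists2 ss, rootprod ss M = 0 & forall s, s \in ss -> s%:M - M \notin unitmx.
Proof.
case: n M => [|n] M; first by exists [::] => //; apply/matrixP=> -[].
have [ss e] := closed_field_poly_normal (char_poly M).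
move: e; rewrite (monicP (char_poly_monic M)) scale1r => e.
exists ss => [|s hs]; first by rewrite rootprod_horner -e Cayley_Hamilton.
have : root (char_poly M) s by rewrite e root_prod_XsubC.
rewrite -eigenvalue_root_char => /eigenvalueP[v ev v0].
apply/negP=> u; move/eqP: v0; apply.
by rewrite -[v](mulmxK u) mulmxBr mul_mx_scalar ev subrr mul0mx.
Qed.

Lemma rootprod0_hurwitz n ss (L : 'M[C]_n) :
  rootprod ss L = 0 -> (forall s, s \in ss -> complex.Re s < 0) -> hurwitz L.
Proof.
move=> e h; apply: hurwitz_eig => l v hl ev.
have := rootprod_eig ss ev; rewrite e mul0mx => /esym/eqP.
rewrite scaler_eq0 => /orP[|/eqP//].
rewrite prodf_seq_eq0 => /hasP[s hs]; rewrite subr_eq0 => /eqP ls.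
by have := h s hs; rewrite -ls ltNge hl.
Qed.

(** If the polynomial [p] annihilates [L2] and has only eigenvalues of [L2] as roots, intertwining
    gives [p(- L1^t* ) Y = Y p(L2) = 0]. The spectrum of [- L1^t*] lies in the open right
    half-plane, so the left factor is invertible. *)
Lemma sylvester0 n p (L1 : 'M[C]_n) (L2 : 'M[C]_p) (Y : 'M_(n, p)) :
  hurwitz L1 -> hurwitz L2 -> L1^t* *m Y + Y *m L2 = 0 -> Y = 0.
Proof.
move=> h1 h2 e; have [ss e2 hs] := rootprod_annihilates L2.
have : - L1^t* *m Y = Y *m L2.
  by rewrite mulNmx; apply/eqP; rewrite eq_sym -addr_eq0 addrC e.
move/(rootprod_intertwine ss); rewrite e2 mulmx0; apply: unitmx_mul0.
apply: rootprod_unit => s /hs us.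
have /h1 : 0 <= complex.Re (- s^*).
  rewrite complexReN complexRe_conj oppr_ge0 leNgt; apply: contra us => rs.
  by apply: h2; exact: ltW.
have -> : - L1^t* - s%:M = ((- s^*)%:M - L1)^t*; last by rewrite unitmx_trC.
by rewrite trmxCB trmxC_scalar conjNK addrC (raddfN (@scalar_mx _ _)).
Qed.

End Complex.

(** * Real matrices over the complex field *)

Section Real.
Variable R : realType.
Local Notation C := R[i].
Local Open Scope sesquilinear_scope.

Lemma cmxM m n p (A : 'M[R]_(m, n)) (B : 'M[R]_(n, p)) : cmx (A *m B) = cmx A *m cmx B.
Proof. exact: (map_mxM (real_complex R)). Qed.
Lemma cmxD m n (A B : 'M[R]_(m, n)) : cmx (A + B) = cmx A + cmx B.
Proof. exact: (map_mxD (real_complex R)). Qed.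
Lemma cmxN m n (A : 'M[R]_(m, n)) : cmx (- A) = - cmx A.
Proof. exact: (map_mxN (real_complex R)). Qed.
Lemma cmxB m n (A B : 'M[R]_(m, n)) : cmx (A - B) = cmx A - cmx B.
Proof. exact: (map_mxB (real_complex R)). Qed.
Lemma cmx0 m n : cmx (0 : 'M[R]_(m, n)) = 0.
Proof. exact: (map_mx0 (real_complex R)). Qed.
Lemma cmx1 n : cmx (1%:M : 'M[R]_n) = 1%:M.
Proof. exact: (map_mx1 (real_complex R)). Qed.
Lemma cmx_block m1 m2 n1 n2 (a : 'M[R]_(m1, n1)) (b : 'M[R]_(m1, n2))
    (c : 'M[R]_(m2, n1)) (d : 'M[R]_(m2, n2)) :
  cmx (block_mx a b c d) = block_mx (cmx a) (cmx b) (cmx c) (cmx d).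
Proof. exact: (map_block_mx (real_complex R)). Qed.
Lemma cmx_tr m n (A : 'M[R]_(m, n)) : cmx A^T = (cmx A)^T.
Proof. by rewrite /cmx map_trmx. Qed.
Lemma cmx_trC m n (A : 'M[R]_(m, n)) : (cmx A)^t* = cmx A^T.
Proof. by apply/matrixP=> i j; rewrite !mxE; apply: conjc_real. Qed.
Lemma cmx_inj m n : injective (@cmx R m n).
Proof. by move=> A B e; apply/matrixP=> i j; move/matrixP/(_ i j): e; rewrite !mxE => -[]. Qed.
Lemma cmx_unit n (A : 'M[R]_n) : (cmx A \in unitmx) = (A \in unitmx).
Proof. exact: (map_unitmx (real_complex R)). Qed.

Definition Remx m n (A : 'M[C]_(m, n)) := map_mx (@complex.Re R) A.
Definition Immx m n (A : 'M[C]_(m, n)) := map_mx (@complex.Im R) A.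
Lemma cmx_ReIm m n (A : 'M[C]_(m, n)) : A = cmx (Remx A) + 'i%C *: cmx (Immx A).
Proof. by apply/matrixP=> i j; rewrite !mxE [LHS]complexE. Qed.

Lemma trmx11 (A : 'M[R]_1) : A^T = A.
Proof. by apply/matrixP=> i j; rewrite !mxE !ord1. Qed.

(** The form at [u + t *: y] is nonnegative for every [t] and has no constant term, so its linear
    coefficient in [t] must vanish for every [y]. *)
Lemma psd_ker n (M : 'M[R]_n) (u : 'cV[R]_n) :
  M^T = M -> psd M -> (u^T *m M *m u) 0 0 = 0 -> M *m u = 0.
Proof.
move=> sM pM e.
pose q (x y : 'cV[R]_n) := (x^T *m M *m y) 0 0.
have qs x y : q x y = q y x.
  by rewrite /q -[x^T *m M *m y]trmx11 !trmx_mul trmxK sM mulmxA.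
suff h y : q y u = 0.
  apply/matrixP=> i j; rewrite [RHS]mxE ord1 -(h (delta_mx i 0)) /q -mulmxA.
  by rewrite trmx_delta -rowE [in RHS]mxE.
have qt t : 0 <= 2 * t * q y u + t ^+ 2 * q y y.
  have -> : 2 * t * q y u + t ^+ 2 * q y y = q (u + t *: y) (u + t *: y); last exact: pM.
  have tE : (u + t *: y)^T = u^T + t *: y^T by rewrite linearD linearZ.
  have qE : q (u + t *: y) (u + t *: y) = q u u + t * q u y + t * (q y u + t * q y y).
    rewrite /q tE !(mulmxDl, mulmxDr) -!scalemxAl -!scalemxAr.
    by rewrite !mxE; ring.
  by rewrite qE [q u u]e (qs u y); ring.
have p := pM y; rewrite -/(q y y) in p.
(* This [t] makes the linear term dominate; the summand 1 in the denominator keeps it positive even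
   when [q y y] is zero. *)
have := qt (- q y u / (q y y + 1)).
have n0 : q y y + 1 != 0 by apply: lt0r_neq0; lra.
set d := q y y + 1; set b := q y u.
have -> : 2 * (- b / d) * b + (- b / d) ^+ 2 * q y y = - (b / d) ^+ 2 * (q y y + 2).
  by rewrite /d; field.
rewrite mulNr oppr_ge0 => h.
have : (b / d) ^+ 2 = 0.
  apply/eqP; rewrite eq_le sqr_ge0 andbT -(pmulr_lle0 _ (_ : 0 < q y y + 2)) //; lra.
by move/eqP; rewrite sqrf_eq0 mulf_eq0 invr_eq0 (negPf n0) orbF => /eqP.
Qed.

(** By symmetry the cross terms of real and imaginary parts cancel, so the Hermitian form is the sum
    of two real forms. *)
Lemma psd_complex n (M : 'M[R]_n) (x : 'cV[C]_n) : M^T = M -> psd M ->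
  0 <= (x^t* *m cmx M *m x) 0 0 /\ ((x^t* *m cmx M *m x) 0 0 = 0 -> cmx M *m x = 0).
Proof.
move=> sM pM; set u := Remx x; set v := Immx x.
have e : (x^t* *m cmx M *m x) = cmx (u^T *m M *m u + v^T *m M *m v).
  have s : v^T *m M *m u = u^T *m M *m v.
    by rewrite -[LHS]trmx11 !trmx_mul trmxK sM mulmxA.
  rewrite (cmx_ReIm x) -/u -/v trmxCD trmxCZ !cmx_trC !(mulmxDl, mulmxDr).
  rewrite -!(scalemxAl, scalemxAr) -!cmxM s cmxD.
  have i2 : ('i%C : C)^* = - 'i%C by apply/eqP; rewrite eq_complex /= oppr0 !eqxx.
  rewrite scalerA i2 !scaleNr mulNr -expr2 sqr_i opprK scale1r.
  by set Z := 'i%C *: _; zmod_abel.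
have -> : (x^t* *m cmx M *m x) 0 0 = ((u^T *m M *m u + v^T *m M *m v) 0 0)%:C%C.
  by rewrite e mxE.
have pu := pM u; have pv := pM v.
split; first by rewrite ler0c mxE addr_ge0.
move=> /complexI; rewrite mxE => /eqP; rewrite paddr_eq0 // => /andP[/eqP eu /eqP ev].
by rewrite (cmx_ReIm x) mulmxDr -scalemxAr -!cmxM !psd_ker // cmx0 scaler0 addr0.
Qed.
End Real.

(** * Algebraic Riccati equations *)

Section Are.
Variable R : realType.
Local Notation C := R[i].
Local Open Scope sesquilinear_scope.

Lemma rootprod_bezout n (M : 'M[C]_n) ps qs :
    (forall p q, p \in ps -> q \in qs -> p != q) ->
  exists U V, U *m rootprod ps M + V *m rootprod qs M = 1%:M.
Proof.
case: n M => [|n] M d; first by exists 0, 0; apply/matrixP=> -[].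
have cp : coprimep (\prod_(p <- ps) ('X - p%:P)) (\prod_(q <- qs) ('X - q%:P)).
  apply/closed_rootP => -[x].
  rewrite root_gcd !root_prod_XsubC => /andP[xp xq].
  by have := d x x xp xq; rewrite eqxx.
have /Bezout_eq1_coprimepP[[u v] /= e] := cp.
exists (horner_mx M u), (horner_mx M v).
by rewrite !rootprod_horner !mulmxE -!rmorphM -rmorphD /= e rmorph1.
Qed.

(** One of the two factors contributed by each root [z] is [X - z], so the product is a multiple of
    an annihilating polynomial. *)
Lemma rootprod_mul0 n (M : 'M[C]_n) ss (f g : C -> C) :
    (forall z, f z = z \/ g z = z) -> rootprod ss M = 0 ->
  rootprod (map f ss) M *m rootprod (map g ss) M = 0.
Proof.
case: n M => [|n] M fg e; first by apply/matrixP=> -[].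
rewrite !rootprod_horner !big_map mulmxE -rmorphM -big_split /=.
(* Since [f z] or [g z] equals [z], the other one is [f z + g z - z]. *)
rewrite (eq_bigr (fun z => ('X - z%:P) * ('X - (f z + g z - z)%:P))).
  by rewrite big_split rmorphM /= -rootprod_horner e mul0r.
by move=> z _; rewrite polyCB polyCD; case: (fg z) => ->; ring.
Qed.

(** Each linear factor becomes minus the adjoint of the original one; this converts the reflected
    polynomial at [- M^t*] into the adjoint of the original, with the same rank. *)
Lemma rootprod_reflect n (M : 'M[C]_n) ps :
  rootprod [seq - s^* | s <- ps] (- M^t*) = (-1) ^+ size ps *: (rootprod ps M)^t*.
Proof.
elim: ps => [|s ps IH] /=; first by rewrite expr0 scale1r trmxC_scalar conjC1.
have comm : rootprod ps M *m (M - s%:M) = (M - s%:M) *m rootprod ps M.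
  by apply: rootprod_intertwine; rewrite mulmxBl mulmxBr mul_scalar_mx mul_mx_scalar.
rewrite -comm trmxC_mul trmxCB trmxC_scalar IH -scalemxAr exprS -scalerA scaleN1r.
rewrite -scalerN -mulNmx; congr (_ *: (_ *m _)).
by rewrite opprB (raddfN (@scalar_mx _ _)) opprK addrC.
Qed.

Lemma kernel_basis N d (P : 'M[C]_N) : (\rank P + d = N)%N ->
  exists (V : 'M_(N, d)) (V' : 'M_(d, N)),
    [/\ P *m V = 0, V' *m V = 1%:M &
        forall q (X : 'M_(N, q)), P *m X = 0 -> exists D, X = V *m D].
Proof.
move=> e; have {e} : d = \rank (kermx P^T) by rewrite mxrank_ker mxrank_tr; lia.
move=> ->; set Z := row_base (kermx P^T).
have ZP : Z *m P^T = 0 by apply/sub_kermxP; rewrite eq_row_base.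
have /row_freeP[B eB] : row_free Z by exact: row_base_free.
exists Z^T, B^T; split.
- by apply: trmx_inj; rewrite trmx_mul trmxK ZP trmx0.
- by rewrite -trmx_mul eB trmx1.
move=> q X eX.
have /submxP[D eD] : (X^T <= Z)%MS.
  by rewrite eq_row_base; apply/sub_kermxP; rewrite -trmx_mul eX trmx0.
by exists D^T; rewrite -trmx_mul -eD trmxK.
Qed.

(** The vanishing product bounds the sum of the ranks from above, the Bezout identity from below. *)
Lemma rank_complementary N (P Q U V : 'M[C]_N) :
  P *m Q = 0 -> U *m P + V *m Q = 1%:M -> (\rank P + \rank Q = N)%N.
Proof.
move=> PQ e; apply/eqP; rewrite eqn_leq (mulmx0_rank_max PQ) /=.
rewrite -[X in (X <= _)%N](mxrank1 C) -e.
by apply: (leq_trans (mxrank_add _ _)); rewrite leq_add // mxrankM_maxr.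
Qed.

(* Replacing every eigenvalue [z] of [H] by the stable one among [z] and [- z^*]
   gives a stable polynomial [p] such that [p] times its reflection annihilates [H];
   the two factors have the same rank at [H] by the symmetry [K], so [p(H)] has rank [n]. *)
Lemma stable_subspace n (H K : 'M[C]_(n + n)) :
    K \in unitmx -> H^t* *m K + K *m H = 0 ->
    (forall l v, complex.Re l = 0 -> H *m v = l *: v -> v = 0 :> 'cV_(n + n)) ->
  exists (V : 'M[C]_(n + n, n)) (L : 'M_n) (V' : 'M_(n, n + n)),
    [/\ H *m V = V *m L, V' *m V = 1%:M & hurwitz L].
Proof.
move=> Ku HK im.
have [ss e hs] := rootprod_annihilates H.
have ss0 z : z \in ss -> complex.Re z != 0.
  move=> /hs/nonunit_ker[v /eqP v0 ev]; apply/eqP => z0; case: v0; apply: (im z) => //.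
  by move/eqP: ev; rewrite mulmxBl mul_scalar_mx subr_eq0 => /eqP.
pose f (z : C) := if complex.Re z < 0 then z else - z^*.
have fneg z : z \in ss -> complex.Re (f z) < 0.
  move/ss0; rewrite /f; case: (ltP (complex.Re z) 0) => // h1 h2.
  by rewrite complexReN complexRe_conj oppr_lt0 lt_neqAle eq_sym h2 h1.
set ps := map f ss; set qs := map (fun z => - z^*) ps.
have PQ : rootprod ps H *m rootprod qs H = 0.
  rewrite /qs /ps -map_comp; apply: rootprod_mul0 => // z.
  rewrite /f /=; case: ifP => _; [by left|right].
  by rewrite conjNK opprK.
have [U [W eUW]] : exists U V, U *m rootprod ps H + V *m rootprod qs H = 1%:M.
  apply: rootprod_bezout => p q /mapP[z hz ->] /mapP[_ /mapP[y hy ->] ->].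
  apply/eqP => /(congr1 (@complex.Re R)); rewrite complexReN complexRe_conj.
  have := fneg z hz; have := fneg y hy; lra.
have rPQ := rank_complementary PQ eUW.
have rQ : \rank (rootprod qs H) = \rank (rootprod ps H).
  have i : - H^t* *m K = K *m H.
    by rewrite mulNmx; apply/eqP; rewrite eq_sym -addr_eq0 addrC HK.
  have := rootprod_intertwine qs i; rewrite rootprod_reflect => /(congr1 mxrank).
  rewrite -scalemxAl mxrank_scale_nz ?signr_eq0 // mxrankMfree ?row_free_unit //.
  rewrite mxrank_map mxrank_tr => ->; rewrite -(mxrank_tr (K *m _)) trmx_mul.
  by rewrite mxrankMfree ?row_free_unit ?unitmx_tr // mxrank_tr.
have [|V [V' [PV VV comp]]] := @kernel_basis (n + n) n (rootprod ps H).
  by move: rPQ; rewrite rQ; lia.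
have [|L eL] := comp _ (H *m V).
  by rewrite mulmxA (rootprod_intertwine ps (erefl (H *m H))) -mulmxA PV mulmx0.
exists V, L, V'; split => //.
(* From [p(H) V = 0] follows [V p(L) = 0], and the left inverse [V'] leaves [p(L) = 0]; the roots of
   [p] are all stable. *)
apply: (@rootprod0_hurwitz _ _ ps); last by move=> s /mapP[z /fneg h ->].
have := rootprod_intertwine ps eL; rewrite PV => /(congr1 (mulmx V')).
by rewrite mulmx0 mulmxA VV mul1mx.
Qed.

Lemma hurwitz_similar n (L T : 'M[C]_n) : T \in unitmx -> hurwitz L ->
  hurwitz (T *m L *m invmx T).
Proof.
move=> Tu hL l /hL u.
have -> : l%:M - T *m L *m invmx T = T *m (l%:M - L) *m invmx T.
  by rewrite mulmxBr mulmxBl mul_mx_scalar -scalemxAl mulmxV // scalemx1.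
by rewrite !unitmx_mul Tu u unitmx_inv.
Qed.

Lemma mulmx_inj_unit n p (T : 'M[C]_n) (A B : 'M_(p, n)) :
  T \in unitmx -> A *m T = B *m T -> A = B.
Proof. by move=> Tu e; rewrite -[A](mulmxK Tu) e mulmxK. Qed.

(** The columns of [col_mx X1 X2] span the stable subspace of the Hamiltonian matrix [H], and the
    solution is [X2] times the inverse of [X1]. The main point is that [X1] is invertible. *)
Lemma are_stabilizing_complex n (a g w : 'M[C]_n) :
    g^t* = g -> w^t* = w ->
    (forall y : 'cV_n, (y^t* *m g *m y) 0 0 = 0 -> g *m y = 0) ->
    (forall l (y : 'cV_n), 0 <= complex.Re l -> a^t* *m y = l *: y -> g *m y = 0 -> y = 0) ->
    (forall l (x y : 'cV_n), complex.Re l = 0 -> a *m x - g *m y = l *: x ->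
       - (w *m x) - a^t* *m y = l *: y -> x = 0 /\ y = 0) ->
  exists2 X, X^t* = X &
    a^t* *m X + X *m a - X *m g *m X + w = 0 /\ hurwitz (a - g *m X).
Proof.
move=> sg sw pg stab im.
pose H : 'M_(n + n) := block_mx a (- g) (- w) (- (a^t*)).
pose J : 'M[C]_(n + n) := block_mx 0 1%:M (- 1%:M) 0.
have HJ : H^t* *m J + J *m H = 0.
  rewrite /H /J trmxC_block !trmxCN sg sw trmxCK !mulmx_block add_block_mx.
  rewrite !(mulmx0, mul0mx, mulmx1, mul1mx, mulmxN, mulNmx, add0r, addr0, opprK).
  by rewrite !(addNr, subrr) block_mx0.
have Ju : J \in unitmx.
  have e : J *m (- J) = 1%:M.
    rewrite mulmxN /J mulmx_block !(mulmx0, mul0mx, mulmx1, mul1mx, add0r, addr0).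
    by rewrite opp_block_mx !oppr0 opprK -scalar_mx_block.
  by case: (mulmx1_unit e).
have [l v l0|V [L [V' [HV VV hL]]]] := stable_subspace Ju HJ.
  rewrite -[v]vsubmxK /H mul_block_col scale_col_mx !mulNmx => /eq_col_mx[e1 e2].
  by have [-> ->] := im l _ _ l0 e1 e2; rewrite col_mx0.
(* The stable subspace is isotropic for [J]: the Gram matrix solves a Sylvester equation with [L] on
   both sides. This is what makes the solution Hermitian. *)
have lag : V^t* *m J *m V = 0.
  apply: (sylvester0 hL hL).
  have -> : V^t* *m J *m V *m L = V^t* *m (J *m H) *m V by rewrite -mulmxA -HV !mulmxA.
  have -> : L^t* *m (V^t* *m J *m V) = V^t* *m (H^t* *m J) *m V.
    by rewrite !mulmxA -(trmxC_mul V L) -HV trmxC_mul.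
  by rewrite -mulmxDl -mulmxDr HJ mulmx0 mul0mx.
set X1 := usubmx V; set X2 := dsubmx V.
have eV : V = col_mx X1 X2 by rewrite vsubmxK.
have [e1 e2] : a *m X1 - g *m X2 = X1 *m L /\ - (w *m X1) - a^t* *m X2 = X2 *m L.
  by move: HV; rewrite eV /H mul_block_col mul_col_mx !mulNmx => /eq_col_mx.
have sX : X1^t* *m X2 = X2^t* *m X1.
  move: lag; rewrite eV tr_col_mx map_row_mx /J mul_row_block mul_row_col.
  rewrite !(mulmx0, mulmx1, mulmxN, add0r, addr0, mulNmx) => /eqP.
  by rewrite addrC subr_eq0 => /eqP.
have V0 (x : 'cV_n) : X1 *m x = 0 -> X2 *m x = 0 -> x = 0.
  by move=> x1 x2; rewrite -[x]mul1mx -VV -mulmxA eV mul_col_mx x1 x2 col_mx0 mulmx0.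
have gX2 (x : 'cV_n) : X1 *m x = 0 -> g *m (X2 *m x) = 0.
  move=> x1; apply: pg.
  have -> : (X2 *m x)^t* *m g *m (X2 *m x) = x^t* *m X2^t* *m (a *m X1 - X1 *m L) *m x.
    by rewrite -e1 opprB addrC subrK trmxC_mul !mulmxA.
  rewrite mulmxBr mulmxBl -!mulmxA x1 !mulmx0 sub0r !mulmxA.
  rewrite -(mulmxA _ (X2^t*) X1) -sX mulmxA -trmxC_mul x1 trmxC0 !mul0mx.
  by rewrite oppr0 mxE.
(* The kernel of [X1] is invariant under [L]. An eigenvector [x] in it would give [X2 *m x], an
   eigenvector of [a^t*] for the unstable value [- l] that [g] annihilates, against
   stabilizability. *)
have X1u : X1 \in unitmx.
  case: (boolP (X1 \in unitmx)) => // /nonunit_ker[x0 n0 x00].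
  have inv (x : 'cV_n) : X1 *m x = 0 -> X1 *m (L *m x) = 0.
    by move=> x1; rewrite mulmxA -e1 mulmxBl -!mulmxA x1 gX2 // mulmx0 subr0.
  have [l [x [/eqP nx x1 ex]]] := eigenvector_in_kernel inv x00 n0.
  have rl : complex.Re l < 0.
    by rewrite ltNge; apply/negP => hl; apply: nx; apply: (eig_hurwitz hL hl ex).
  case: nx; apply: (V0 _ x1); apply: (stab (- l)); last exact: gX2.
    by rewrite complexReN oppr_ge0 ltW.
  move/(congr1 (mulmx^~ x)): e2; rewrite mulmxBl mulNmx -!mulmxA x1 ex mulmx0 oppr0 sub0r.
  by rewrite -scalemxAr scaleNr => <-; rewrite opprK.
have [X eX] : exists X, X *m X1 = X2 by exists (X2 *m invmx X1); rewrite mulmxKV.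
have hX : X^t* = X.
  apply: (mulmx_inj_unit X1u); rewrite eX.
  have X1u' : X1^t* \in unitmx by rewrite unitmx_trC.
  apply/eqP; rewrite -subr_eq0; apply/eqP; apply: (unitmx_mul0 X1u').
  by rewrite mulmxBr mulmxA -trmxC_mul eX sX subrr.
have eL : a - g *m X = X1 *m L *m invmx X1.
  by apply: (mulmx_inj_unit X1u); rewrite mulmxKV // mulmxBl -mulmxA eX.
exists X => //; split; last by rewrite eL; apply: hurwitz_similar.
have : - w - a^t* *m X = X *m (a - g *m X).
  by apply: (mulmx_inj_unit X1u); rewrite eL !mulmxA mulmxKV // eX mulmxBl mulNmx -mulmxA eX.
rewrite mulmxBr mulmxA => /eqP; rewrite -subr_eq0 => /eqP e.
rewrite -[RHS]oppr0 -e; zmod_abel.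
Qed.

(** The entrywise conjugate of the complex solution is again a stabilizing solution because the data
    are real. The difference of the two solves a Sylvester equation with Hurwitz coefficients, so
    the solution is real. *)
Lemma are_stabilizing n (a g w : 'M[R]_n) :
    g^T = g -> w^T = w -> psd g ->
    (forall l (y : 'cV[C]_n), 0 <= complex.Re l ->
       cmx a^T *m y = l *: y -> cmx g *m y = 0 -> y = 0) ->
    (forall l (x y : 'cV[C]_n), complex.Re l = 0 -> cmx a *m x - cmx g *m y = l *: x ->
       - (cmx w *m x) - cmx a^T *m y = l *: y -> x = 0 /\ y = 0) ->
  exists2 X : 'M[R]_n, X^T = X &
    a^T *m X + X *m a - X *m g *m X + w = 0 /\ hurwitz (cmx (a - g *m X)).
Proof.
move=> sg sw pg stab im.
have [||y|l y||X hX [eX hL]] := @are_stabilizing_complex n (cmx a) (cmx g) (cmx w).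
- by rewrite cmx_trC sg.
- by rewrite cmx_trC sw.
- by apply: (proj2 (psd_complex _ sg pg)).
- by rewrite cmx_trC; apply: stab.
- by rewrite cmx_trC; apply: im.
pose Y := map_mx Num.conj X.
have cK m1 m2 (M : 'M[R]_(m1, m2)) : map_mx Num.conj (cmx M) = cmx M.
  by apply/matrixP=> i j; rewrite !mxE; apply: conjc_real.
have hY : Y^t* = Y by apply: (congr1 (map_mx Num.conj)); rewrite -[RHS]hX map_trmx.
have eY : (cmx a)^t* *m Y + Y *m cmx a - Y *m cmx g *m Y + cmx w = 0.
  move/(congr1 (map_mx Num.conj)): eX; rewrite cmx_trC.
  by rewrite map_mxD map_mxB map_mxD !map_mxM !cK map_mx0.
have hLY : hurwitz (cmx a - cmx g *m Y).
  move=> l hl; have := hL l^*; rewrite complexRe_conj => /(_ hl).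
  rewrite -(map_unitmx Num.conj) map_mxB map_scalar_mx map_mxB map_mxM !cK.
  by rewrite /= conjCK.
have XY : X - Y = 0.
  apply: (sylvester0 hL hLY).
  rewrite trmxCB trmxC_mul hX (cmx_trC g) sg !(mulmxBl, mulmxBr) !mulmxA.
  rewrite -[RHS](subrr 0) -[X in _ = X - _]eX -[X in _ = _ - X]eY; zmod_abel.
have rX : X = cmx (Remx X).
  apply/matrixP=> i j; move/matrixP/(_ i j): XY; rewrite !mxE.
  case: (X i j) => u v /eqP; rewrite eq_complex /= opprK => /andP[_ /eqP v0].
  by congr Complex; lra.
exists (Remx X).
  apply: cmx_inj; rewrite -cmx_trC -rX; exact: hX.
split; last by rewrite cmxB cmxM -rX.
by apply: cmx_inj; rewrite cmx0 -[RHS]eX cmx_trC cmxD cmxB cmxD !cmxM -rX.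
Qed.
End Are.

(** * Generalized Riccati equations *)

Section Descriptor.
Variable R : realType.
Local Notation C := R[i].
Local Open Scope sesquilinear_scope.

Lemma trmxD m n (A B : 'M[R]_(m, n)) : (A + B)^T = A^T + B^T.
Proof. exact: linearD. Qed.
Lemma trmxB m n (A B : 'M[R]_(m, n)) : (A - B)^T = A^T - B^T.
Proof. exact: linearB. Qed.

(* [G] stands for [B *m B^T]. *)
Definition stabilizable_finite n (E A G : 'M[R]_n) := forall l (y : 'cV[C]_n),
  0 <= complex.Re l -> cmx A^T *m y = l *: (cmx E^T *m y) -> cmx G *m y = 0 -> y = 0.

(* Impulse controllability: no [u != 0] is orthogonal to the columns of [E], [A *m S], [B]. *)
Definition stabilizable_infinite n (E A G : 'M[R]_n) := forall u : 'cV[R]_n,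
  E^T *m u = 0 -> G *m u = 0 -> (forall z : 'cV_n, E *m z = 0 -> u^T *m A *m z = 0) -> u = 0.

Definition gare n (E A G W P : 'M[R]_n) :=
  A^T *m P + P^T *m A - P^T *m G *m P + W = 0 /\ E^T *m P = P^T *m E.

(** A singular pencil has an eigenvector for every [l], so this condition contains regularity as
    well. *)
Definition stable_finite n (E M : 'M[R]_n) := forall l (x : 'cV[C]_n),
  0 <= complex.Re l -> cmx M *m x = l *: (cmx E *m x) -> x = 0.

(** A coordinate-free form of impulse-freeness: no nonzero vector of the kernel of [E] is sent by
    [M] into the image of [E]. *)
Definition index1 n (E M : 'M[R]_n) := forall x z : 'cV[R]_n,
  E *m x = 0 -> M *m x = E *m z -> x = 0.

(** The Hamiltonian pencil of the Riccati equation has no eigenvalue on the imaginary axis. *)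
Definition no_imaginary n (E A G W : 'M[R]_n) := forall l (x y : 'cV[C]_n),
  complex.Re l = 0 -> cmx A *m x - cmx G *m y = l *: (cmx E *m x) ->
  - (cmx W *m x) - cmx A^T *m y = l *: (cmx E^T *m y) -> x = 0 /\ y = 0.

(** Pairing the first equation with [y] and the second with [x], the [E] terms cancel on the
    imaginary axis and two nonnegative forms sum to zero. Then [G y = 0] and [W x = 0], and the two
    rank conditions give [y = 0] and [x = 0]. *)
Lemma psd_no_imaginary n (E A G W : 'M[R]_n) :
  G^T = G -> psd G -> W^T = W -> psd W ->
  stabilizable_finite E A G -> stabilizable_finite E^T A^T W -> no_imaginary E A G W.
Proof.
move=> sG pG sW pW sE dE l x y l0 e1 e2.
have [G0 Gk] := psd_complex y sG pG; have [W0 Wk] := psd_complex x sW pW.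
have s : y^t* *m cmx G *m y + x^t* *m cmx W *m x = 0.
  have := congr1 (fun z => y^t* *m z) e1; have := congr1 (fun z => (z^t* *m x)) e2.
  rewrite /= !trmxCB !trmxCN !trmxCZ !trmxC_mul !cmx_trC !trmxK sW conj_Re0 //.
  rewrite mulmxBr mulmxBl mulNmx -scalemxAl -scalemxAr !mulmxA scaleNr => f2 f1.
  by rewrite -[RHS]oppr0 -(subrr (l *: (y^t* *m cmx E *m x))) -{1}f1 -f2; zmod_abel.
have /eqP : (y^t* *m cmx G *m y) 0 0 + (x^t* *m cmx W *m x) 0 0 = 0.
  by move/matrixP/(_ 0 0): s; rewrite !mxE.
rewrite paddr_eq0 // => /andP[/eqP/Gk gy /eqP/Wk wx].
split; [apply: (dE l)|apply: (sE (- l))]; rewrite ?trmxK ?complexReN ?l0 ?oppr0 //.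
  by rewrite -e1 gy subr0.
by rewrite scaleNr -e2 wx oppr0 sub0r opprK.
Qed.

(** * Invariance under independent changes of basis on both sides *)

Section Transform.
Variables (n : nat) (U V : 'M[R]_n).
Hypotheses (Uu : U \in unitmx) (Vu : V \in unitmx).

Lemma mulmx_unitl p (A B : 'M[C]_(n, p)) (T : 'M[R]_n) : T \in unitmx ->
  cmx T *m A = cmx T *m B -> A = B.
Proof. by rewrite -cmx_unit => Tu e; rewrite -[A](mulKmx Tu) e mulKmx. Qed.

Lemma mulmx_unitl0 p (A : 'M[C]_(n, p)) (T : 'M[R]_n) : T \in unitmx ->
  cmx T *m A = 0 -> A = 0.
Proof. by move=> Tu e; apply: (mulmx_unitl Tu); rewrite e mulmx0. Qed.

Lemma stabilizable_finite_transform E A G : stabilizable_finite E A G ->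
  stabilizable_finite (U *m E *m V) (U *m A *m V) (U *m G *m U^T).
Proof.
move=> s l y hl e1 e2; apply: (@mulmx_unitl0 _ _ U^T); rewrite ?unitmx_tr //.
apply: (s l) => //.
  apply: (@mulmx_unitl _ _ _ V^T); first by rewrite unitmx_tr.
  by rewrite -scalemxAr !mulmxA -!cmxM -!trmx_mul !mulmxA.
by apply: (mulmx_unitl0 Uu); rewrite !mulmxA -!cmxM.
Qed.

Lemma stabilizable_infinite_transform E A G : stabilizable_infinite E A G ->
  stabilizable_infinite (U *m E *m V) (U *m A *m V) (U *m G *m U^T).
Proof.
move=> s u e1 e2 e3.
have UT : U^T \in unitmx by rewrite unitmx_tr.
have VT : V^T \in unitmx by rewrite unitmx_tr.
rewrite -[u](mulKmx UT) (s (U^T *m u)) ?mulmx0 //.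
- apply: (can_inj (mulKmx VT)).
  by rewrite !mulmxA -!trmx_mul mulmxA e1 mulmx0.
- by apply: (can_inj (mulKmx Uu)); rewrite !mulmxA e2 mulmx0.
move=> z Ez; rewrite trmx_mul trmxK.
have := e3 (invmx V *m z); rewrite !mulmxA !mulmxK // => -> //.
by rewrite -mulmxA Ez mulmx0.
Qed.

Lemma no_imaginary_transform E A G W : no_imaginary E A G W ->
  no_imaginary (U *m E *m V) (U *m A *m V) (U *m G *m U^T) (V^T *m W *m V).
Proof.
move=> s l x y l0; rewrite !trmx_mul !cmxM => e1 e2.
have [||x0 y0] := s l (cmx V *m x) (cmx U^T *m y) l0.
- apply: (mulmx_unitl Uu); rewrite -scalemxAr mulmxBr.
  by move: e1; rewrite !mulmxA.
- apply: (@mulmx_unitl _ _ _ V^T); first by rewrite unitmx_tr.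
  rewrite -scalemxAr mulmxBr mulmxN.
  by move: e2; rewrite !mulmxA.
by rewrite (mulmx_unitl0 Vu x0) (mulmx_unitl0 _ y0) // unitmx_tr.
Qed.

(** Both equations for [P] are the equations for [X = U^T P V^-1] multiplied by [V^T] on the left
    and [V] on the right, which can be cancelled. *)
Lemma gare_transform E A G W P :
  gare (U *m E *m V) (U *m A *m V) (U *m G *m U^T) (V^T *m W *m V) P ->
  gare E A G W (U^T *m P *m invmx V).
Proof.
move=> [e1 e2].
have VT : V^T \in unitmx by rewrite unitmx_tr.
have cancel (M N : 'M[R]_n) : V^T *m M *m V = V^T *m N *m V -> M = N.
  by move/(congr1 (mulmx^~ (invmx V))); rewrite !mulmxK // => /(congr1 (mulmx (invmx V^T))); rewrite !mulKmx.
have [X [tX XV ->]] : exists X, [/\ V^T *m X^T = P^T *m U, X *m V = U^T *m P & U^T *m P *m invmx V = X].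
  exists (U^T *m P *m invmx V); split; rewrite ?mulmxKV //.
  by rewrite !trmx_mul trmxK trmx_inv mulKVmx.
split; apply: cancel.
  rewrite mulmx0 mul0mx -[RHS]e1 !(mulmxDr, mulmxDl, mulmxN, mulNmx) !trmx_mul !mulmxA.
  by rewrite tX -!(mulmxA _ X V) XV !mulmxA.
by move: e2; rewrite !trmx_mul !mulmxA tX -!(mulmxA _ X V) XV !mulmxA.
Qed.

Lemma closed_loop_transform A G P :
  U *m A *m V - U *m G *m U^T *m P = U *m (A - G *m (U^T *m P *m invmx V)) *m V.
Proof. by rewrite mulmxBr mulmxBl -!mulmxA mulVmx // mulmx1. Qed.

Lemma stable_finite_transform E M : stable_finite (U *m E *m V) (U *m M *m V) -> stable_finite E M.
Proof.
move=> s l x hl e.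
have Vx : cmx V *m (cmx (invmx V) *m x) = x by rewrite mulmxA -cmxM mulmxV // cmx1 mul1mx.
rewrite -Vx (s l (cmx (invmx V) *m x)) ?mulmx0 //.
by rewrite !cmxM -!mulmxA Vx e -scalemxAr.
Qed.

Lemma index1_transform E M : index1 (U *m E *m V) (U *m M *m V) -> index1 E M.
Proof.
move=> s x z ex mx; rewrite -(mulKVmx Vu x) (s (invmx V *m x) (invmx V *m z)) ?mulmx0 //.
  by rewrite -!mulmxA mulKVmx // ex mulmx0.
by rewrite -!mulmxA !mulKVmx // mx.
Qed.

End Transform.

(** * Shifting a Riccati equation by a reference matrix [P0] *)

Section Shift.
Variables (n : nat) (E A G W P0 : 'M[R]_n).
Hypotheses (sG : G^T = G) (sP0 : E^T *m P0 = P0^T *m E).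
Let A' := A - G *m P0.
(** The residual of [P0] in the original equation, which takes the place of the weight and may be
    indefinite. *)
Let W' := W + A^T *m P0 + P0^T *m A - P0^T *m G *m P0.

Lemma stabilizable_finite_shift : stabilizable_finite E A G -> stabilizable_finite E A' G.
Proof.
move=> s l y hl e1 e2; apply: (s l) => //; rewrite -e1.
by rewrite trmxB trmx_mul sG cmxB cmxM mulmxBl -(mulmxA (cmx P0^T)) e2 mulmx0 subr0.
Qed.

(** The substitution of [y + P0 x] for [y] turns one Hamiltonian pencil into the other. *)
Lemma no_imaginary_shift : no_imaginary E A G W -> no_imaginary E A' G W'.
Proof.
move=> s l x y l0 e1 e2.
have e1' : cmx A *m x - cmx G *m (y + cmx P0 *m x) = l *: (cmx E *m x).
  by rewrite -e1 cmxB cmxM mulmxBl mulmxDr mulmxA; zmod_abel.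
have [||x0] := s l x (y + cmx P0 *m x) l0 => //; last by rewrite x0 mulmx0 addr0.
have sP : cmx E^T *m (cmx P0 *m x) = cmx P0^T *m (cmx E *m x).
  by rewrite !mulmxA -!cmxM sP0.
rewrite !mulmxDr scalerDr -e2 sP scalemxAr -e1'.
rewrite trmxB trmx_mul sG !(cmxN, cmxD, cmxM) !(mulmxDl, mulmxDr, mulmxN, mulNmx) !mulmxA.
by zmod_abel.
Qed.

Lemma gare_shift P : gare E A' G W' P -> gare E A G W (P0 + P).
Proof.
move=> [e1 e2]; split; last by rewrite trmxD mulmxDr mulmxDl e2 sP0.
rewrite -[RHS]e1 /A' /W' trmxB trmxD trmx_mul sG.
rewrite !(mulmxDl, mulmxDr, mulmxN, mulNmx) !mulmxA.
by zmod_abel.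
Qed.
End Shift.
End Descriptor.

(** * Descriptor systems in normal coordinates *)

Section Normal.
Variable R : realType.
Local Notation C := R[i].
Local Open Scope sesquilinear_scope.

(** * Block-diagonal systems with identity lower right block *)

Section Diag.
Variables (r k : nat).
Definition E0 : 'M[R]_(r + k) := block_mx 1%:M 0 0 0.

Lemma E0_tr : E0^T = E0. Proof. by rewrite tr_block_mx trmx1 !trmx0. Qed.

Lemma E0_mul_col q (x1 : 'M[C]_(r, q)) (x2 : 'M[C]_(k, q)) :
  cmx E0 *m col_mx x1 x2 = col_mx x1 0.
Proof. by rewrite cmx_block mul_block_col cmx1 !cmx0 mul1mx !mul0mx !addr0. Qed.

Lemma E0_mul_colR q (x1 : 'M[R]_(r, q)) (x2 : 'M[R]_(k, q)) :
  E0 *m col_mx x1 x2 = col_mx x1 0.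
Proof. by rewrite mul_block_col mul1mx !mul0mx !addr0. Qed.

Lemma block_triangular_stable (m11 : 'M[R]_r) (m21 : 'M_(k, r)) (m22 : 'M_k) :
  m22 \in unitmx -> hurwitz (cmx m11) ->
  stable_finite E0 (block_mx m11 0 m21 m22) /\ index1 E0 (block_mx m11 0 m21 m22).
Proof.
move=> u h; split.
  move=> l x hl; rewrite -[x]vsubmxK E0_mul_col cmx_block mul_block_col scale_col_mx.
  rewrite cmx0 mul0mx addr0 scaler0 => /eq_col_mx[/(eig_hurwitz h hl) x1].
  rewrite x1 mulmx0 add0r => /(mulmx_unitl0 u) ->; exact: col_mx0.
move=> x z; rewrite -[x]vsubmxK -[z]vsubmxK !E0_mul_colR -[X in _ = X]col_mx0.
move=> /eq_col_mx[x1 _]; rewrite mul_block_col x1 !mulmx0 !add0r mul0mx.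
by move=> /eq_col_mx[_ e]; rewrite -[dsubmx x](mulKmx u) e mulmx0 col_mx0.
Qed.

Variables (a g11 w11 : 'M[R]_r) (g12 w12 : 'M[R]_(r, k)) (g22 : 'M[R]_k).
Let G : 'M[R]_(r + k) := block_mx g11 g12 g12^T g22.
Let W : 'M[R]_(r + k) := block_mx w11 w12 w12^T 0.
Let A : 'M[R]_(r + k) := block_mx a 0 0 1%:M.
Hypotheses (sG : G^T = G) (pG : psd G) (sW : w11^T = w11).
Hypotheses (stab : stabilizable_finite E0 A G) (im : no_imaginary E0 A G W).

Let al := a + g12 *m w12^T.
Let w := w11 - w12 *m g22 *m w12^T.

(* The off-diagonal block of the equation forces [P2 = - w12^T]; substituting it
   leaves the Riccati equation for [P1] with data [al], [g11], [w]. *)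
Lemma gare_diag : exists P1 : 'M[R]_r, exists P2 : 'M[R]_(k, r),
  let P := block_mx P1 0 P2 0 in
  [/\ gare E0 A G W P, stable_finite E0 (A - G *m P) & index1 E0 (A - G *m P)].
Proof.
have [s11 _ _ s22] : [/\ g11^T = g11, g12^T^T = g12, g12^T = g12^T & g22^T = g22].
  by move: sG; rewrite /G tr_block_mx => /eq_block_mx[].
have pg11 : psd g11.
  move=> x; have := pG (col_mx x 0).
  rewrite tr_col_mx trmx0 mul_row_block mul_row_col !mul0mx !mulmx0 !addr0 //.
(* Semidefiniteness puts [col_mx y 0] into the kernel of [G], so stabilizability of the full system
   can be used on the upper block alone. *)
have g21_0 (y : 'cV[C]_r) : cmx g11 *m y = 0 -> cmx g12^T *m y = 0.
  move=> e; have [_] := psd_complex (col_mx y 0) sG pG.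
  rewrite -mulmxA cmx_block mul_block_col !mulmx0 !addr0 e.
  rewrite tr_col_mx map_row_mx trmxC0 mul_row_col mulmx0 mul0mx addr0 mxE.
  by move=> /(_ erefl); rewrite -[X in _ = X]col_mx0 => /eq_col_mx[].
have sw : w^T = w by rewrite /w trmxB sW !trmx_mul trmxK s22 !mulmxA.
have [||P1 sP1 [eP1 hP1]] := @are_stabilizing R r al g11 w s11 sw pg11.
- move=> l y hl ey gy.
  have: col_mx y 0 = 0 :> 'cV[C]_(r + k).
    apply: (stab hl); rewrite ?E0_tr.
      rewrite E0_mul_col /A tr_block_mx !trmx0 trmx1 cmx_block mul_block_col.
      rewrite !mulmx0 !addr0 !cmx0 mul0mx scale_col_mx scaler0 -ey; congr col_mx.
      by rewrite /al trmxD trmx_mul trmxK cmxD cmxM mulmxDl -mulmxA g21_0 // mulmx0 addr0.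
    by rewrite /G cmx_block mul_block_col !mulmx0 !addr0 gy g21_0 // col_mx0.
  by rewrite -[X in _ = X]col_mx0 => /eq_col_mx[].
- move=> l x y l0 e1 e2.
  (* The rows in which [E0] vanishes are algebraic and determine [y2] from [x], then [x2] from [y]
     and [y2]; eliminating both leaves the reduced Hamiltonian. *)
  pose x2 := cmx g12^T *m y - cmx g22 *m (cmx w12^T *m x).
  pose y2 := - (cmx w12^T *m x).
  have [] := im (l := l) (x := col_mx x x2) (y := col_mx y y2) l0.
  + rewrite E0_mul_col /A /G !cmx_block !mul_block_col !cmx0 cmx1 !mul0mx mul1mx.
    rewrite addr0 add0r opp_col_mx add_col_mx scale_col_mx scaler0 -e1; congr col_mx.
      by rewrite /al /y2 cmxD cmxM mulmxDl mulmxN -!mulmxA; zmod_abel.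
    by rewrite /x2 /y2 mulmxN subrr.
  + rewrite E0_tr E0_mul_col /A /W tr_block_mx !trmx0 trmx1 !cmx_block !mul_block_col.
    rewrite !cmx0 cmx1 !mul0mx mul1mx addr0 add0r addr0 !opp_col_mx add_col_mx scale_col_mx.
    rewrite scaler0 -e2; congr col_mx; last by rewrite /y2 subrr.
    rewrite /w /al /x2 trmxD trmx_mul trmxK !(cmxD, cmxN, cmxM) !(mulmxDl, mulmxDr, mulmxN, mulNmx).
    by rewrite -!mulmxA; zmod_abel.
  by rewrite -col_mx0 => /eq_col_mx[-> _] /eq_col_mx[-> _].
exists P1, (- w12^T) => P.
have eAc : A - G *m P = block_mx (al - g11 *m P1) 0 (g22 *m w12^T - g12^T *m P1) 1%:M.
  rewrite /A /G /P mulmx_block !mulmx0 !addr0 opp_block_mx add_block_mx.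
  by rewrite !mulmxN /al; congr block_mx; zmod_abel.
have [h1 h2] := block_triangular_stable (g22 *m w12^T - g12^T *m P1) (unitmx1 _ _) hP1.
split; rewrite ?eAc //; split.
  rewrite /A /G /W /P !tr_block_mx !trmx0 trmx1 linearN /= trmxK sP1 !mulmx_block.
  rewrite !(mulmx0, mul0mx, addr0, add0r, mulmx1, mul1mx).
  rewrite opp_block_mx !add_block_mx -[RHS]block_mx0; congr block_mx.
  - rewrite -[RHS]eP1 /al /w trmxD trmx_mul trmxK.
    by rewrite !(mulmxDl, mulmxDr, mulmxN, mulNmx) !mulmxA; zmod_abel.
  - zmod_abel.
  - zmod_abel.
  - zmod_abel.
rewrite E0_tr /E0 /P tr_block_mx !mulmx_block !trmx0 sP1.
by rewrite !(mulmx0, mul0mx, addr0, add0r, mulmx1, mul1mx).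
Qed.
End Diag.
End Normal.

(** * Reduction of the general lower right block to the block-diagonal case *)

Section Normal.
Variable R : realType.
Local Notation C := R[i].
Local Open Scope sesquilinear_scope.

Lemma hurwitz_unit n (c : 'M[R]_n) : hurwitz (cmx c) -> c \in unitmx.
Proof.
move=> h; rewrite -cmx_unit; case: (boolP (_ \in unitmx)) => // /nonunit_ker[v /eqP v0 e].
by case: v0; apply: (@eig_hurwitz _ _ _ 0 _ h); rewrite /= ?lexx // e scale0r.
Qed.

Lemma psd_congr n p (U : 'M[R]_(p, n)) (G : 'M[R]_n) : psd G -> psd (U *m G *m U^T).
Proof. by move=> pG x; have := pG (U^T *m x); rewrite trmx_mul trmxK !mulmxA. Qed.

Lemma cmx_ker m n (M : 'M[R]_(m, n)) (y : 'cV[C]_n) : cmx M *m y = 0 ->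
  M *m Remx y = 0 /\ M *m Immx y = 0.
Proof.
rewrite {1}(cmx_ReIm y) mulmxDr -scalemxAr -!cmxM => /matrixP e.
by split; apply/matrixP=> i j; have := e i j; rewrite [LHS]mxE [X in _ + X]mxE ![cmx _ _ _]mxE
  ![(0 : 'M__) _ _]mxE => /eqP; rewrite eq_complex /=
  !(mul0r, mul1r, mulr0, add0r, addr0, subr0, oppr0) => /andP[/eqP ? /eqP ?].
Qed.

(** For a symmetric matrix this excludes positive eigenvalues; it moves every eigenvector for the
    closed right half-plane into the kernel. *)
Definition nonpositive n (a : 'M[R]_n) := a^T = a /\
  forall l (y : 'cV[C]_n), 0 <= complex.Re l -> cmx a *m y = l *: y -> cmx a *m y = 0.

Lemma nonpositive_pid n q : nonpositive (- pid_mx q : 'M[R]_n).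
Proof.
split; first by rewrite linearN /= tr_pid_mx.
move=> l y hl; rewrite cmxN !mulNmx => e.
set p := cmx _ in e *.
have pp : p *m (p *m y) = p *m y.
  by rewrite mulmxA -cmxM mul_pid_mx minnn pid_mx_minv.
have /eqP : (1 + l) *: (p *m y) = 0.
  by rewrite scalerDl scale1r scalemxAr -e mulmxN pp subrr.
rewrite scaler_eq0 => /orP[|/eqP->]; last exact: oppr0.
by rewrite addrC addr_eq0 => /eqP l1; move: hl; rewrite l1 complexReN /= oppr_ge0 ler10.
Qed.

(** Impulse controllability tests only the kernel of [a22], through the vectors [col_mx 0 u].
    Nonpositivity ensures that an unstable eigenvector of [a22] lies in that kernel. *)
Lemma stabilizable_infinite_dr (r k : nat) (a11 : 'M[R]_r) (a12 : 'M[R]_(r, k))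
    (a21 : 'M[R]_(k, r)) (a22 : 'M[R]_k) (G : 'M[R]_(r + k)) :
    let A := block_mx a11 a12 a21 a22 in let E0 := E0 R r k in
    G^T = G -> psd G -> nonpositive a22 ->
    stabilizable_infinite E0 A G -> stabilizable_finite 1%:M a22 (drsubmx G).
Proof.
move=> A E0 sG pG [s22 n22] s l y hl.
rewrite trmx1 cmx1 mul1mx s22 => e gy.
have ay := n22 l y hl e.
have key (u : 'cV[R]_k) : a22 *m u = 0 -> drsubmx G *m u = 0 -> u = 0.
  move=> au gu; have: col_mx 0 u = 0 :> 'cV[R]_(r + k).
    apply: s.
    - by rewrite E0_tr E0_mul_colR col_mx0.
    - apply: psd_ker => //; rewrite -[G]submxK.
      rewrite tr_col_mx trmx0 mul_row_block mul_row_col !mul0mx !mulmx0 !add0r.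
      by rewrite -mulmxA gu mulmx0 mxE.
    move=> z; rewrite -[z]vsubmxK E0_mul_colR -[X in _ = X -> _]col_mx0 => /eq_col_mx[-> _].
    rewrite tr_col_mx trmx0 mul_row_block mul_row_col !mul0mx !mulmx0 !add0r.
    by rewrite -[a22]s22 -trmx_mul au trmx0 mul0mx.
  by rewrite -[X in _ = X -> _]col_mx0 => /eq_col_mx[].
have [u1 u2] := cmx_ker ay; have [g1 g2] := cmx_ker gy.
by rewrite (cmx_ReIm y) (key _ u1 g1) (key _ u2 g2) cmx0 scaler0 addr0.
Qed.

(** Block elimination with pivot [c]. The factors are triangular in the sense that leaves [E0]
    unchanged. *)
Lemma schur_diagonalization (r k : nat) (m11 : 'M[R]_r) (m12 : 'M[R]_(r, k))
    (m21 : 'M[R]_(k, r)) (c : 'M[R]_k) : c \in unitmx ->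
  let U : 'M[R]_(r + k) := block_mx 1%:M (- (m12 *m invmx c)) 0 (invmx c) in
  let V : 'M[R]_(r + k) := block_mx 1%:M 0 (- (invmx c *m m21)) 1%:M in
  [/\ U \in unitmx, V \in unitmx, U *m E0 R r k *m V = E0 R r k &
      U *m block_mx m11 m12 m21 c *m V = block_mx (m11 - m12 *m invmx c *m m21) 0 0 1%:M].
Proof.
move=> cu; split.
- by rewrite unitmxE det_ublock det1 mul1r -unitmxE unitmx_inv.
- by rewrite unitmxE det_lblock !det1 mul1r unitr1.
- rewrite /E0 !mulmx_block.
  by rewrite !(mulmx0, mul0mx, addr0, add0r, mulmx1, mul1mx).
rewrite !mulmx_block !(mulmx0, mul0mx, addr0, add0r, mulmx1, mul1mx).
rewrite !mulNmx mulmxKV // subrr mul0mx addr0 mulVmx //.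
by rewrite mul1mx subrr.
Qed.

(** Shifting by the lower right solution [X] makes the pivot [c] Hurwitz, hence invertible, and
    cancels the lower right weight; after elimination [gare_diag] applies. The shape of [P] and the
    equation for [X] are recorded for the coupling argument. *)
Lemma gare_normal (r k : nat) (a11 : 'M[R]_r) (a12 : 'M[R]_(r, k)) (a21 : 'M[R]_(k, r))
    (a22 : 'M[R]_k) (g11 w11 : 'M[R]_r) (g12 w12 : 'M[R]_(r, k)) (g22 w22 : 'M[R]_k) :
    let A := block_mx a11 a12 a21 a22 in let E := E0 R r k in
    let G := block_mx g11 g12 g12^T g22 in let W := block_mx w11 w12 w12^T w22 in
    G^T = G -> psd G -> W^T = W -> psd W -> nonpositive a22 ->
    stabilizable_finite E A G -> stabilizable_infinite E A G ->
    stabilizable_finite E A^T W -> stabilizable_infinite E A^T W ->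
  exists P1 P2 X, let P := block_mx P1 0 P2 X in
    [/\ X^T = X, a22^T *m X + X *m a22 - X *m g22 *m X + w22 = 0,
        hurwitz (cmx (a22 - g22 *m X)), gare E A G W P &
        stable_finite E (A - G *m P) /\ index1 E (A - G *m P)].
Proof.
move=> A E G W sG pG sW pW n22 sf si df di.
have [s22 _] := n22.
have [_ _ _ sg22] : [/\ g11^T = g11, g12^T^T = g12, g12^T = g12^T & g22^T = g22].
  by move: sG; rewrite /G tr_block_mx => /eq_block_mx[].
have [sw11 _ _ sw22] : [/\ w11^T = w11, w12^T^T = w12, w12^T = w12^T & w22^T = w22].
  by move: sW; rewrite /W tr_block_mx => /eq_block_mx[].
have psd_dr (g : 'M[R]_r) h h' (g' : 'M[R]_k) : psd (block_mx g h h' g') -> psd g'.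
  move=> p x; have := p (col_mx 0 x).
  by rewrite tr_col_mx trmx0 mul_row_block mul_row_col !mul0mx !mulmx0 !add0r.
have pg22 := psd_dr _ _ _ _ pG; have pw22 := psd_dr _ _ _ _ pW.
have sf2 := stabilizable_infinite_dr sG pG n22 si; rewrite block_mxKdr in sf2.
have df2 : stabilizable_finite (1%:M)^T a22^T w22.
  have n22' : nonpositive a22^T by rewrite s22.
  rewrite trmx1 -[w22](block_mxKdr w11 w12 w12^T).
  apply: (@stabilizable_infinite_dr _ _ a11^T a21^T a12^T) => //.
  by move: di; rewrite /A tr_block_mx.
have im2 := psd_no_imaginary sg22 pg22 sw22 pw22 sf2 df2.
have [||X sX [eX hX]] := @are_stabilizing R k a22 g22 w22 sg22 sw22 pg22.
- by move=> l y hl e; apply: (sf2 l) => //; rewrite trmx1 cmx1 mul1mx.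
- by move=> l x y hl e1 e2; apply: (im2 l); rewrite ?trmx1 ?cmx1 ?mul1mx.
have := hurwitz_unit hX; set c := a22 - g22 *m X => cu.
pose P0 : 'M[R]_(r + k) := block_mx 0 0 0 X.
have sP0 : E^T *m P0 = P0^T *m E.
  rewrite /E E0_tr /E0 /P0 tr_block_mx !mulmx_block !trmx0.
  by rewrite !(mulmx0, mul0mx, addr0).
have sA := stabilizable_finite_shift (P0 := P0) sG sf.
have dE : stabilizable_finite E^T A^T W by rewrite /E E0_tr.
have imA := no_imaginary_shift sG sP0 (psd_no_imaginary sG pG sW pW sf dE).
have shift := gare_shift (W := W) (A := A) sG sP0.
set A' := A - G *m P0 in sA imA shift; set W' := W + _ + _ - _ in imA shift.
pose b12 := a12 - g12 *m X; pose v12 := w12 + a21^T *m X.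
have eA' : A' = block_mx a11 b12 a21 c.
  rewrite /A' /A /G /P0 mulmx_block !mulmx0 !addr0 !add0r opp_block_mx add_block_mx.
  by rewrite !oppr0 !addr0.
have eW' : W' = block_mx w11 v12 v12^T 0.
  rewrite /W' /W /A /G /P0 !tr_block_mx !trmx0 sX !mulmx_block !(mulmx0, mul0mx, addr0, add0r).
  rewrite opp_block_mx !add_block_mx !(oppr0, addr0, add0r).
  rewrite /v12 trmxD trmx_mul trmxK sX -eX; congr block_mx; zmod_abel.
have [] := schur_diagonalization a11 b12 a21 cu; rewrite -eA'.
set U := block_mx _ _ 0 _; set V := block_mx 1%:M 0 _ _ => Uu Vu eE eA.
(* Since the lower right block of [W'] is zero, the congruence by [V] alters only its upper left
   block. *)
have [z ez] : exists z, V^T *m W' *m V = block_mx z v12 v12^T 0.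
  rewrite eW' /V tr_block_mx !trmx1 trmx0 !mulmx_block.
  rewrite !(mulmx0, mul0mx, addr0, add0r, mulmx1, mul1mx).
  by eexists.
have sW' : W'^T = W' by rewrite eW' tr_block_mx sw11 trmxK trmx0.
have sz : z^T = z.
  have := congr1 trmx ez; rewrite !trmx_mul trmxK sW' mulmxA ez tr_block_mx.
  by move=> /eq_block_mx[<-].
have sGU : (U *m G *m U^T)^T = U *m G *m U^T by rewrite !trmx_mul trmxK sG !mulmxA.
have pGU := psd_congr U pG.
have := stabilizable_finite_transform Uu Vu sA; have := no_imaginary_transform Uu Vu imA.
have tr := gare_transform (E := E) (A := A') (G := G) (U := U) (W := W') Vu.
have cl := @closed_loop_transform _ _ U V Vu A' G.
move: sGU pGU tr cl; set GU := U *m G *m U^T => sGU pGU.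
have eG : GU = block_mx (ulsubmx GU) (ursubmx GU) (ursubmx GU)^T (drsubmx GU).
  by rewrite trmx_ursub sGU submxK.
rewrite ez eE eA => tr cl im s.
rewrite eG in sGU pGU im s tr cl.
have [Q1 [Q2 [gP fP iP]]] := gare_diag sGU pGU sz s im.
have eY := shift _ (tr _ gP).
set P'' := block_mx Q1 0 Q2 0 in gP fP iP eY.
have YV : U^T *m P'' *m invmx V *m V = U^T *m P'' by rewrite mulmxKV.
have clP := cl P''.
move: YV clP eY; set Y := U^T *m P'' *m invmx V => YV clP eY.
(* Undoing the elimination keeps the right block column zero, so the lower right block of [P0 + Y]
   is exactly [X]. *)
have [y12 y22] : ursubmx Y = 0 /\ drsubmx Y = 0.
  move: YV; rewrite -[Y in Y *m V]submxK /U /V /P'' tr_block_mx !mulmx_block.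
  rewrite !(mulmx0, mul0mx, addr0, add0r, mulmx1, mul1mx).
  by move=> /eq_block_mx[_ ? _ ?].
exists (ulsubmx Y), (dlsubmx Y), X => P.
have eP : P0 + Y = P.
  by rewrite -[Y]submxK y12 y22 /P0 /P add_block_mx !add0r addr0.
have clE : A - G *m P = A' - G *m Y by rewrite -eP mulmxDr /A'; zmod_abel.
split=> //; first by rewrite -eP.
rewrite clE; split.
  by apply: (stable_finite_transform (U := U) Vu); rewrite -clP eE.
by apply: (index1_transform (U := U) Vu); rewrite -clP eE.
Qed.

End Normal.

(** * Stable pencils *)

Section Pencil.
Variable R : realType.
Local Notation C := R[i].
Local Open Scope sesquilinear_scope.

Lemma castmx_E0 r k n (H : (r + k)%N = n) : castmx (H, H) (E0 R r k) = pid_mx r.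
Proof. by case: _ / H; rewrite castmx_id pid_mx_block. Qed.

Lemma rank_normal_form n (E : 'M[R]_n) :
  exists r k (H : (r + k)%N = n) (L T : 'M[R]_n),
    [/\ L \in unitmx, T \in unitmx & L *m E *m T = castmx (H, H) (E0 R r k)].
Proof.
exists (\rank E), (n - \rank E)%N, (subnKC (rank_leq_row E)).
exists (invmx (col_ebase E)), (invmx (row_ebase E)).
have cu := col_ebase_unit E; have ru := row_ebase_unit E.
split; rewrite ?unitmx_inv //.
by rewrite castmx_E0 -{2}[E]mulmx_ebase !mulmxA mulVmx // mul1mx mulmxK.
Qed.

Lemma stable_finite_pull n (U V E M : 'M[R]_n) : U \in unitmx -> V \in unitmx ->
  stable_finite E M -> stable_finite (U *m E *m V) (U *m M *m V).
Proof.
move=> Uu Vu s l x hl; rewrite !cmxM -!mulmxA scalemxAr => /(mulmx_unitl Uu) e.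
by apply: (mulmx_unitl0 Vu); apply: (s l).
Qed.

Lemma index1_pull n (U V E M : 'M[R]_n) : U \in unitmx -> V \in unitmx ->
  index1 E M -> index1 (U *m E *m V) (U *m M *m V).
Proof.
move=> Uu Vu s x z e1 e2.
have ex : E *m (V *m x) = 0.
  by apply: (can_inj (mulKmx Uu)); rewrite !mulmxA e1 mulmx0.
have mx : M *m (V *m x) = E *m (V *m z).
  by apply: (can_inj (mulKmx Uu)); rewrite !mulmxA.
by rewrite -[x](mulKmx Vu) (s _ _ ex mx) mulmx0.
Qed.

(** A kernel vector [v] of the lower right block gives [col_mx 0 v], which lies in the kernel of
    [E0] and is mapped by [M] into its image. *)
Lemma index1_E0 r k (M : 'M[R]_(r + k)) : index1 (E0 R r k) M -> drsubmx M \in unitmx.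
Proof.
move=> i; rewrite -unitmx_tr -row_free_unit; apply: inj_row_free => v ev.
have {}ev : drsubmx M *m v^T = 0 by rewrite -[drsubmx M]trmxK -trmx_mul ev trmx0.
have: col_mx 0 v^T = 0 :> 'cV[R]_(r + k).
  apply: (i _ (col_mx (ursubmx M *m v^T) 0)); rewrite E0_mul_colR ?col_mx0 //.
  by rewrite -[M]submxK mul_block_col !mulmx0 !add0r ev block_mxKur.
by rewrite -[X in _ = X -> _]col_mx0 => /eq_col_mx[_ /(congr1 trmx)]; rewrite trmxK trmx0.
Qed.

Lemma E0_index1 r k (W : 'M[R]_r) : index1 (E0 R r k) (block_mx W 0 0 1%:M).
Proof.
move=> x z; rewrite -[x]vsubmxK -[z]vsubmxK !E0_mul_colR -[X in _ = X]col_mx0.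
move=> /eq_col_mx[-> _]; rewrite mul_block_col !mulmx0 !add0r mul1mx.
by move=> /eq_col_mx[_ ->]; rewrite col_mx0.
Qed.

Lemma weierstrass_stable r k (E M L T : 'M[R]_(r + k)) :
    L \in unitmx -> T \in unitmx -> L *m E *m T = E0 R r k ->
    stable_finite E M -> index1 E M ->
  exists U V W, [/\ U \in unitmx, V \in unitmx, U *m E *m V = E0 R r k,
    U *m M *m V = block_mx W 0 0 1%:M & hurwitz (cmx W)].
Proof.
move=> Lu Tu eE sf i1.
have := index1_pull Lu Tu i1; rewrite eE => /index1_E0.
set c := drsubmx _ => cu.
have [m11 [m12 [m21 eM]]] : exists m11 m12 m21, L *m M *m T = block_mx m11 m12 m21 c.
  by exists (ulsubmx (L *m M *m T)), (ursubmx (L *m M *m T)), (dlsubmx (L *m M *m T)); rewrite submxK.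
have [] := schur_diagonalization m11 m12 m21 cu.
set U := block_mx _ _ 0 _; set V := block_mx 1%:M 0 _ _ => Uu Vu eE0 eD.
exists (U *m L), (T *m V), (m11 - m12 *m invmx c *m m21).
have e1 : U *m L *m E *m (T *m V) = E0 R r k by rewrite -eE0 -eE !mulmxA.
have e2 : U *m L *m M *m (T *m V) = block_mx (m11 - m12 *m invmx c *m m21) 0 0 1%:M.
  by rewrite -eD -eM !mulmxA.
have u1 : U *m L \in unitmx by rewrite unitmx_mul Uu.
have u2 : T *m V \in unitmx by rewrite unitmx_mul Tu.
split=> //; have := stable_finite_pull u1 u2 sf; rewrite e1 e2 => s.
apply: hurwitz_eig => l v hl ev.
have: col_mx v 0 = 0 :> 'cV[C]_(r + k).
  apply: (s l) => //; rewrite E0_mul_col cmx_block mul_block_col !mulmx0 !addr0.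
  by rewrite cmx0 mul0mx scale_col_mx scaler0 ev.
by rewrite -[X in _ = X -> _]col_mx0 => /eq_col_mx[].
Qed.

Lemma stable_pencilP n (E M : 'M[R]_n) :
  stable_pencil E M <-> stable_finite E M /\ index1 E M.
Proof.
split=> [[_ [r [k [H [P [Pt [W [N [[Pu Ptu _ eE eM] N0]]]]]]]] fe]|[s i]].
  split.
    move=> l x hl e; apply/eqP; apply: contraT => x0.
    by have := fe l (ex_intro _ x (conj x0 (esym e))); rewrite ltNge hl.
  case: _ / H E M P Pt Pu Ptu eE eM {fe} => E M P Pt Pu Ptu; rewrite !castmx_id N0 => eE eM.
  by apply: (@index1_transform _ _ (invmx P) Pt); rewrite // eE eM; apply: E0_index1.
split.
(* Regularity is witnessed at 1, a point of the closed right half-plane and hence not an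
   eigenvalue. *)
- exists 1; rewrite -unitfE -unitmxE.
  case: (boolP (_ \in unitmx)) => // /nonunit_ker[v /eqP v0].
  rewrite mulmxBl => /eqP; rewrite subr_eq0 -scalemxAl => /eqP e.
  by case: v0; apply: (s 1); rewrite /= ?ler01.
- have [r [k [H [L [T [Lu Tu]]]]]] := rank_normal_form E.
  case: _ / H E M L T Lu Tu s i => E M L T Lu Tu s i; rewrite castmx_id => eE.
  have [U [V [W [Uu Vu e1 e2 hW]]]] := weierstrass_stable Lu Tu eE s i.
  exists r, k, (erefl _), (invmx U), V, W, 0; split => //.
  by split; rewrite ?unitmx_inv ?invmxK ?castmx_id //; exists 1%N; rewrite expr1.
move=> l [v [v0 e]]; rewrite ltNge; apply/negP=> hl.
by move/eqP: v0; apply; apply: (s l).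
Qed.

Lemma stable_pencil_of_tr n (E M : 'M[R]_n) : stable_pencil E^T M^T -> stable_pencil E M.
Proof.
move=> [[s es] [r [k [H [P [Pt [W [N [[Pu Ptu _ eE eM] N0]]]]]]]] fe].
have tc (l : C) : (l *: cmx E^T - cmx M^T) = (l *: cmx E - cmx M)^T.
  by rewrite !cmx_tr linearB linearZ.
split.
- by exists s; rewrite -det_tr -tc.
- exists r, k, H, (invmx Pt)^T, (invmx P)^T, W^T, 0; split => //.
  split; rewrite ?unitmx_tr ?unitmx_inv //; first by exists 1%N; rewrite expr1.
    apply: trmx_inj; rewrite !trmx_mul trmxK !trmx_inv invmxK !trmxK mulmxA eE N0 trmx_cast /=.
    by rewrite tr_block_mx !trmx0 trmx1.
  apply: trmx_inj; rewrite !trmx_mul trmxK !trmx_inv invmxK !trmxK mulmxA eM trmx_cast /=.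
  by rewrite tr_block_mx !trmx0 trmx1 trmxK.
move=> l [v [/eqP v0 e]].
have : l *: cmx E^T - cmx M^T \notin unitmx.
  rewrite tc unitmx_tr; apply/negP => u; apply: v0; apply: (unitmx_mul0 u).
  by rewrite mulmxBl -scalemxAl e subrr.
move=> /nonunit_ker[w w0]; rewrite mulmxBl -scalemxAl => /eqP; rewrite subr_eq0 => /eqP ew.
by apply: fe; exists w.
Qed.

Lemma stable_pencil_tr n (E M : 'M[R]_n) : stable_pencil E^T M^T <-> stable_pencil E M.
Proof. by split => [|h]; apply: stable_pencil_of_tr; rewrite ?trmxK. Qed.

(** Each pencil is put into its own Weierstrass form. The symmetry of [E^T D] leaves only the upper
    left block of the transformed product, and that block satisfies an ordinary Sylvester
    equation. *)
Lemma descriptor_sylvester0 n (E M1 M2 D : 'M[R]_n) :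
    stable_pencil E M1 -> stable_pencil E M2 ->
    M1^T *m D + D^T *m M2 = 0 -> E^T *m D = D^T *m E -> E^T *m D = 0.
Proof.
move=> /stable_pencilP[s1 i1] /stable_pencilP[s2 i2].
have [r [k [H [L [T [Lu Tu]]]]]] := rank_normal_form E.
case: _ / H E M1 M2 D L T Lu Tu s1 i1 s2 i2 => E M1 M2 D L T Lu Tu s1 i1 s2 i2.
rewrite castmx_id => eE eM eD.
have [U1 [V1 [W1 [U1u V1u e1 m1 h1]]]] := weierstrass_stable Lu Tu eE s1 i1.
have [U2 [V2 [W2 [U2u V2u e2 m2 h2]]]] := weierstrass_stable Lu Tu eE s2 i2.
(* [Z] and [Y] are [D] and [D^T] in mixed coordinates; the two pencils use different bases, so they
   are not transposes of each other. *)
have [Y eY] : exists Y, V1^T *m D^T *m invmx U2 = Y by eexists.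
have [Z eZ] : exists Z, invmx U1^T *m D *m V2 = Z by eexists.
have V1T : V1^T \in unitmx by rewrite unitmx_tr.
have U1T : U1^T \in unitmx by rewrite unitmx_tr.
have eEZ : (E0 R r k)^T *m Z = V1^T *m (E^T *m D) *m V2.
  by rewrite -e1 !trmx_mul -eZ !mulmxA mulmxK.
have eEY : Y *m E0 R r k = V1^T *m (E^T *m D) *m V2.
  by rewrite eD -e2 -eY !mulmxA mulmxKV.
have eMM : (block_mx W1 0 0 1%:M)^T *m Z + Y *m block_mx W2 0 0 1%:M = 0.
  have -> : (block_mx W1 0 0 1%:M)^T *m Z = V1^T *m (M1^T *m D) *m V2.
    by rewrite -m1 !trmx_mul -eZ !mulmxA mulmxK.
  have -> : Y *m block_mx W2 0 0 1%:M = V1^T *m (D^T *m M2) *m V2.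
    by rewrite -m2 -eY !mulmxA mulmxKV.
  by rewrite -mulmxDl -mulmxDr eM mulmx0 mul0mx.
have E0Z : (E0 R r k)^T *m Z = 0.
  have := eEZ; rewrite -eEY; move: eMM; rewrite E0_tr -[Z]submxK -[Y]submxK /E0.
  rewrite tr_block_mx !trmx0 trmx1 !mulmx_block.
  rewrite !(mulmx0, mul0mx, addr0, add0r, mulmx1, mul1mx) add_block_mx.
  rewrite -[X in _ = X -> _]block_mx0 => /eq_block_mx[z11 _ _ _] /eq_block_mx[zy -> _ _].
  rewrite -zy in z11; suff -> : ulsubmx Z = 0 by rewrite block_mx0.
  by apply: cmx_inj; rewrite cmx0; apply: (sylvester0 h1 h2); rewrite cmx_trC -!cmxM -cmxD z11 cmx0.
apply: (can_inj (mulKmx V1T)); apply: (can_inj (mulmxK V2u)).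
by rewrite -eEZ E0Z mulmx0 mul0mx.
Qed.
End Pencil.

(** * Coupling of the two Riccati equations *)

Section Coupling.
Variable R : realType.
Local Notation C := R[i].
Local Open Scope sesquilinear_scope.

(* The quadratic form of the second equation at [y = P x] and that of the first at
   [x] cancel up to [y^* S y], whence [S y = 0]. *)
Lemma gare_coupling n (E A G W S P F : 'M[R]_n) (x : 'cV[C]_n) :
    G^T = G -> W^T = W -> S^T = S -> psd S ->
    gare E A G W P -> gare E^T A^T W (G + S) F ->
    x + cmx F *m (cmx P *m x) = 0 ->
  let z := cmx (A - G *m P) *m x in
    z + cmx F^T *m (cmx P^T *m z) = 0 /\
    cmx (A^T - W *m F) *m (cmx P *m x) = - (cmx P^T *m z).
Proof.
move=> sG sW sS pS [eP _] [eF _] ex z.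
have [y ey] : exists y, cmx P *m x = y by eexists.
rewrite ey in ex *.
have Fy : cmx F *m y = - x by apply/eqP; rewrite -addr_eq0 addrC ex.
have ez : z = cmx A *m x - cmx G *m y by rewrite /z cmxB cmxM mulmxBl -!mulmxA ey.
have e1 : cmx A^T *m y + cmx P^T *m z + cmx W *m x = 0.
  have : cmx (A^T *m P + P^T *m A - P^T *m G *m P + W) *m x = 0 by rewrite eP cmx0 mul0mx.
  rewrite !(cmxD, cmxN, cmxM) !(mulmxDl, mulNmx) -!mulmxA ey => <-.
  by rewrite ez mulmxDr mulmxN; zmod_abel.
have e2 : - (cmx A *m x) + cmx F^T *m (cmx A^T *m y + cmx W *m x) + cmx G *m y + cmx S *m y = 0.
  have : cmx (A^T^T *m F + F^T *m A^T - F^T *m W *m F + (G + S)) *m y = 0.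
    by rewrite eF cmx0 mul0mx.
  rewrite trmxK !(cmxD, cmxN, cmxM) !(mulmxDl, mulNmx) -!mulmxA Fy !mulmxN => <-.
  by rewrite !mulmxDr; zmod_abel.
have yS : y^t* = x^t* *m cmx P^T by rewrite -ey trmxC_mul cmx_trC.
have yF : y^t* *m cmx F^T = - x^t* by rewrite -trmxCN -Fy trmxC_mul cmx_trC.
have Sy : cmx S *m y = 0.
  apply: (proj2 (psd_complex y sS pS)).
  suff -> : y^t* *m cmx S *m y = 0 by rewrite mxE.
  have f1 : x^t* *m (cmx A^T *m y) + y^t* *m z + x^t* *m (cmx W *m x) = 0.
    by rewrite yS -!mulmxA -!mulmxDr e1 mulmx0.
  have f2 : - (y^t* *m (cmx A *m x)) - x^t* *m (cmx A^T *m y) - x^t* *m (cmx W *m x)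
      + y^t* *m (cmx G *m y) + y^t* *m (cmx S *m y) = 0.
    have := congr1 (mulmx (y^t*)) e2; rewrite mulmx0 !mulmxDr mulmxN => <-.
    by rewrite !(mulmxA _ (cmx F^T)) yF !mulNmx; zmod_abel.
  rewrite -mulmxA -[RHS]addr0 -{1}f1 -f2 ez mulmxDr mulmxN; zmod_abel.
rewrite Sy addr0 in e2.
have e3 : cmx A^T *m y + cmx W *m x = - (cmx P^T *m z).
  by apply/eqP; rewrite -addr_eq0 -e1; apply/eqP; zmod_abel.
split; last by rewrite cmxB cmxM mulmxBl -mulmxA Fy mulmxN opprK.
by rewrite -[RHS]oppr0 -e2 e3 ez; rewrite !mulmxN; zmod_abel.
Qed.

Lemma unit_add1_cmx n (M : 'M[R]_n) :
  1%:M + M \notin unitmx -> exists2 x : 'cV[C]_n, x != 0 & x + cmx M *m x = 0.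
Proof.
rewrite -cmx_unit => /nonunit_ker[x x0]; rewrite cmxD cmx1 mulmxDl mul1mx => e.
by exists x.
Qed.

(** The case of identity [E], used for the lower right blocks: an eigenvector [x] of the control
    loop in the kernel of [1 + F P] has a stable eigenvalue [l], and [P x] belongs to [- l] in the
    filter loop, so [P x = 0] and then [x = 0]. *)
Lemma coupling_unit_standard n (A G W S P F : 'M[R]_n) :
    G^T = G -> W^T = W -> S^T = S -> psd S -> P^T = P -> F^T = F ->
    A^T *m P + P *m A - P *m G *m P + W = 0 ->
    A^T^T *m F + F *m A^T - F *m W *m F + (G + S) = 0 ->
    hurwitz (cmx (A - G *m P)) -> hurwitz (cmx (A^T - W *m F)) ->
  1%:M + F *m P \in unitmx.
Proof.
move=> sG sW sS pS sP sF eP eF hP hF.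
case: (boolP (_ \in unitmx)) => // /unit_add1_cmx[x0 n0 x00].
have gP : gare 1%:M A G W P by split; rewrite ?trmx1 ?mul1mx ?mulmx1 sP.
have gF : gare (1%:M)^T A^T W (G + S) F by split; rewrite ?trmx1 ?mul1mx ?mulmx1 sF.
have inK (x : 'cV[C]_n) : (1%:M + cmx (F *m P)) *m x = 0 -> x + cmx F *m (cmx P *m x) = 0.
  by rewrite mulmxDl mul1mx cmxM -mulmxA.
have inv (x : 'cV[C]_n) : (1%:M + cmx (F *m P)) *m x = 0 ->
    (1%:M + cmx (F *m P)) *m (cmx (A - G *m P) *m x) = 0.
  move=> /inK/(gare_coupling sG sW sS pS gP gF)[+ _]; rewrite sP sF => <-.
  by rewrite mulmxDl mul1mx cmxM -!mulmxA.
have x00' : (1%:M + cmx (F *m P)) *m x0 = 0 by rewrite mulmxDl mul1mx.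
have [l [x [/eqP nx /inK kx ex]]] := eigenvector_in_kernel inv x00' n0.
have rl : complex.Re l < 0.
  by rewrite ltNge; apply/negP => hl; apply: nx; apply: (eig_hurwitz hP hl ex).
have [_] := gare_coupling sG sW sS pS gP gF kx.
rewrite sP ex -scalemxAr -scaleNr => ey; case: nx.
have y0 : cmx P *m x = 0.
  by apply: (eig_hurwitz hF _ ey); rewrite complexReN oppr_ge0 ltW.
by move: kx; rewrite y0 mulmx0 addr0.
Qed.

(** The matrix is block triangular with diagonal blocks [D1] and [D2]. As [D2] is invertible by
    hypothesis, the eigenvector argument is run on the kernel of [D1]. *)
Lemma coupling_unit r k (A G W S : 'M[R]_(r + k)) (P1 F1 : 'M[R]_r) (P2 F2 : 'M[R]_(k, r))
    (X Y : 'M[R]_k) :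
    let E := E0 R r k in
    let P := block_mx P1 0 P2 X in let F := block_mx F1 0 F2 Y in
    G^T = G -> W^T = W -> S^T = S -> psd S -> X^T = X -> Y^T = Y ->
    gare E A G W P -> gare E A^T W (G + S) F ->
    stable_finite E (A - G *m P) -> stable_finite E (A^T - W *m F) ->
    1%:M + Y *m X \in unitmx ->
  1%:M + F^T *m P^T \in unitmx.
Proof.
move=> E P F sG sW sS pS sX sY gP gF hP hF D2u.
have sym (Q : 'M[R]_(r + k)) : E^T *m Q = Q^T *m E -> (ulsubmx Q)^T = ulsubmx Q.
  rewrite /E E0_tr -{1 2}[Q]submxK /E0 tr_block_mx !mulmx_block.
  by rewrite !(mul1mx, mulmx1, mul0mx, mulmx0, addr0, add0r) => /eq_block_mx[].
have sP1 : P1^T = P1 by have := sym _ gP.2; rewrite block_mxKul.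
have sF1 : F1^T = F1.
  by have := sym F; rewrite block_mxKul => -> //; rewrite gF.2.
rewrite -[E in gare E A^T]E0_tr in gF.
set D2 := 1%:M + Y *m X in D2u; pose D1 := 1%:M + F1 *m P1.
have eB : 1%:M + F^T *m P^T = block_mx D1 (F1 *m P2^T + F2^T *m X) 0 D2.
  rewrite /F /P !tr_block_mx !trmx0 sP1 sF1 sX sY scalar_mx_block mulmx_block add_block_mx.
  by rewrite !(mul1mx, mulmx1, mul0mx, mulmx0, addr0, add0r).
suff D1u : D1 \in unitmx by rewrite eB unitmxE det_ublock unitrM -!unitmxE D1u.
case: (boolP (_ \in unitmx)) => // /unit_add1_cmx[x0 n0 x00].
(* [T] is the lower component that completes a kernel vector [x] of [D1] to a kernel vector of
   [1 + F P]; [L] is then the upper row of the closed loop. *)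
pose T := - invmx D2 *m (F2 *m P1 + Y *m P2).
pose L := ulsubmx (A - G *m P) + ursubmx (A - G *m P) *m T.
have inN (x : 'cV[C]_r) : cmx D1 *m x = 0 ->
    let x' := col_mx x (cmx T *m x) in x' + cmx F *m (cmx P *m x') = 0.
  move=> ex x'; rewrite mulmxA -cmxM /F /P mulmx_block /x' !(mulmx0, mul0mx, addr0, add0r).
  rewrite cmx_block mul_block_col cmx0 mul0mx addr0 add_col_mx -[RHS]col_mx0; congr col_mx.
    by rewrite -[RHS]ex cmxD cmx1 mulmxDl mul1mx.
  have e : D2 *m T = - (F2 *m P1 + Y *m P2) by rewrite /T mulNmx mulmxN mulKVmx.
  have e' : cmx T *m x + cmx (Y *m X) *m (cmx T *m x) = - (cmx (F2 *m P1 + Y *m P2) *m x).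
    by rewrite -mulNmx -cmxN -e /D2 mulmxDl mul1mx cmxD mulmxDl (cmxM (Y *m X)) mulmxA.
  by rewrite addrCA e' subrr.
(* The coupling sends the completed vector into the kernel of [1 + F^T P^T]; its triangular shape
   forces a zero lower component and an upper component in the kernel of [D1]. *)
have key (x : 'cV[C]_r) : cmx D1 *m x = 0 -> 
    cmx D1 *m (cmx L *m x) = 0 /\
    cmx (A - G *m P) *m col_mx x (cmx T *m x) = col_mx (cmx L *m x) 0.
  move=> /inN/(gare_coupling sG sW sS pS gP gF)[+ _]; rewrite mulmxA -cmxM.
  set z := cmx _ *m col_mx _ _ => ez.
  have {}ez : cmx (1%:M + F^T *m P^T) *m z = 0 by rewrite cmxD cmx1 mulmxDl mul1mx.
  have uz : usubmx z = cmx L *m x.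
    rewrite /z -[A - G *m P]submxK cmx_block mul_block_col col_mxKu.
    by rewrite /L cmxD mulmxDl cmxM -mulmxA.
  move: ez; rewrite eB -[z]vsubmxK cmx_block mul_block_col cmx0 mul0mx add0r.
  rewrite -[X in _ = X -> _]col_mx0 => /eq_col_mx[+ /(mulmx_unitl0 D2u) d0].
  by rewrite d0 mulmx0 addr0 uz.
have x00' : cmx D1 *m x0 = 0 by rewrite cmxD cmx1 mulmxDl mul1mx.
have [l [x [/eqP nx kx ex]]] := eigenvector_in_kernel (fun x h => (key x h).1) x00' n0.
set x' := col_mx x (cmx T *m x).
have x'0 : x' = 0 -> x = 0 by rewrite -[X in _ = X -> _]col_mx0 => /eq_col_mx[].
have Ex' : cmx (A - G *m P) *m x' = l *: (cmx E *m x').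
  by rewrite (key x kx).2 ex /E E0_mul_col scale_col_mx scaler0.
have rl : complex.Re l < 0.
  by rewrite ltNge; apply/negP => hl; apply: nx; apply: x'0; apply: (hP l).
have [_] := gare_coupling sG sW sS pS gP gF (inN x kx).
have eP : cmx P^T *m (cmx E *m x') = cmx E *m (cmx P *m x').
  by rewrite !mulmxA -!cmxM -gP.2 /E E0_tr.
rewrite -/x' Ex' -scalemxAr -scaleNr eP => ey.
case: nx; apply: x'0.
have y0 : cmx P *m x' = 0.
  by apply: (hF _ _ _ ey); rewrite complexReN oppr_ge0 ltW.
have e0 : x' + cmx F *m (cmx P *m x') = 0 := inN x kx.
by move: e0; rewrite y0 mulmx0 addr0.
Qed.
End Coupling.

(** * Simultaneous existence of control and filter solutions *)

Section Existence.
Variable R : realType.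
Local Notation C := R[i].
Local Open Scope sesquilinear_scope.

Lemma psdD n (G S : 'M[R]_n) : psd G -> psd S -> psd (G + S).
Proof. by move=> pG pS x; rewrite mulmxDr mulmxDl mxE addr_ge0. Qed.

(** This transfers stabilizability from [G] to the constant term [G + S] of the filter equation. *)
Lemma psdD_ker n (G S : 'M[R]_n) (y : 'cV[C]_n) : G^T = G -> psd G -> S^T = S -> psd S ->
  cmx (G + S) *m y = 0 -> cmx G *m y = 0.
Proof.
move=> sG pG sS pS e.
have [g0 gk] := psd_complex y sG pG; have [s0 _] := psd_complex y sS pS.
have : y^t* *m cmx G *m y + y^t* *m cmx S *m y = 0.
  by rewrite -mulmxDl -mulmxDr -cmxD -mulmxA e mulmx0.
move/matrixP/(_ 0 0); rewrite mxE [RHS]mxE => /eqP.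
by rewrite paddr_eq0 // => /andP[/eqP/gk].
Qed.

Lemma psdD_kerR n (G S : 'M[R]_n) (y : 'cV[R]_n) : G^T = G -> psd G -> S^T = S -> psd S ->
  (G + S) *m y = 0 -> G *m y = 0.
Proof.
move=> sG pG sS pS e; apply: cmx_inj; rewrite cmxM cmx0.
by apply: (psdD_ker sG pG sS pS); rewrite -cmxM e cmx0.
Qed.

Lemma coupled_solutions_normal r k (A G W S : 'M[R]_(r + k)) q :
    let E := E0 R r k in
    G^T = G -> psd G -> W^T = W -> psd W -> S^T = S -> psd S ->
    drsubmx A = - pid_mx q ->
    stabilizable_finite E A G -> stabilizable_infinite E A G ->
    stabilizable_finite E A^T W -> stabilizable_infinite E A^T W ->
  exists P F, [/\ gare E A G W P,
    stable_finite E (A - G *m P) /\ index1 E (A - G *m P),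
    gare E A^T W (G + S) F,
    stable_finite E (A^T - W *m F) /\ index1 E (A^T - W *m F) &
    1%:M + F^T *m P^T \in unitmx].
Proof.
move=> E sG pG sW pW sS pS eA sf si df di.
have sym_block (M : 'M[R]_(r + k)) : M^T = M ->
    M = block_mx (ulsubmx M) (ursubmx M) (ursubmx M)^T (drsubmx M).
  by move=> sM; rewrite trmx_ursub sM submxK.
have sGS : (G + S)^T = G + S by rewrite trmxD sG sS.
have sfS : stabilizable_finite E A^T^T (G + S).
  by rewrite trmxK => l y hl e /(psdD_ker sG pG sS pS); exact: (sf l y hl e).
have siS : stabilizable_infinite E A^T^T (G + S).
  by rewrite trmxK => u e /(psdD_kerR sG pG sS pS) g; exact: si.
have nA := nonpositive_pid R k q; rewrite -eA in nA.
have nAT : nonpositive (drsubmx A)^T by rewrite nA.1.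
have := @gare_normal R r k (ulsubmx A) (ursubmx A) (dlsubmx A) (drsubmx A)
  (ulsubmx G) (ulsubmx W) (ursubmx G) (ursubmx W) (drsubmx G) (drsubmx W).
rewrite submxK -!sym_block // => /(_ sG pG sW pW nA sf si df di)[P1 [P2 [X]]].
set P := block_mx P1 _ _ _ => -[sX eX hX gP cP].
have := @gare_normal R r k (ulsubmx A)^T (dlsubmx A)^T (ursubmx A)^T (drsubmx A)^T
  (ulsubmx W) (ulsubmx (G + S)) (ursubmx W) (ursubmx (G + S)) (drsubmx W) (drsubmx (G + S)).
rewrite -tr_block_mx submxK -!sym_block // => /(_ sW pW sGS (psdD pG pS) nAT df di sfS siS)[F1 [F2 [Y]]].
set F := block_mx F1 _ _ _ => -[sY eY hY gF cF].
exists P, F; split=> //.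
have dr (M : 'M[R]_(r + k)) : M^T = M -> (drsubmx M)^T = drsubmx M.
  by move=> sM; rewrite trmx_drsub sM.
apply: (@coupling_unit _ _ _ A G W S) => //; [exact: cP.1|exact: cF.1|].
have pS22 : psd (drsubmx S).
  move=> x; have := pS (col_mx 0 x); rewrite -[S in _ *m S *m _]submxK.
  by rewrite tr_col_mx trmx0 mul_row_block mul_row_col !mul0mx !mulmx0 !add0r.
(* The lower right blocks solve a coupled pair of ordinary Riccati equations, which supplies the
   invertible diagonal block. *)
apply: (@coupling_unit_standard _ _ (drsubmx A) (drsubmx G) (drsubmx W) (drsubmx S)) => //.
- exact: dr.
- exact: dr.
- exact: dr.
- rewrite -[RHS]eY; congr (_ + _).
  by apply/matrixP=> i j; rewrite !mxE.
Qed.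

Lemma coupled_solutions n (E A G W S : 'M[R]_n) :
    G^T = G -> psd G -> W^T = W -> psd W -> S^T = S -> psd S ->
    stabilizable_finite E A G -> stabilizable_infinite E A G ->
    stabilizable_finite E^T A^T W -> stabilizable_infinite E^T A^T W ->
  exists P F, [/\ gare E A G W P, stable_pencil E (A - G *m P),
    gare E^T A^T W (G + S) F, stable_pencil E^T (A^T - W *m F) &
    1%:M + F^T *m P^T \in unitmx].
Proof.
have [r [k [H [L [T [Lu Tu]]]]]] := rank_normal_form E.
case: _ / H E A G W S L T Lu Tu => E A G W S L T Lu Tu; rewrite castmx_id => eE.
move=> sG pG sW pW sS pS sf si df di.
set a := drsubmx (L *m A *m T).
(* These factors normalize the lower right block to [- pid_mx] while fixing [E0]; the sign makes
   that block nonpositive. *)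
pose U1 : 'M[R]_(r + k) := block_mx 1%:M 0 0 (- invmx (col_ebase a)).
pose V1 : 'M[R]_(r + k) := block_mx 1%:M 0 0 (invmx (row_ebase a)).
have ca := col_ebase_unit a; have ra := row_ebase_unit a.
have U1u : U1 \in unitmx.
  rewrite unitmxE det_ublock det1 mul1r -unitmxE -[- _]scaleN1r unitmxZ ?unitmx_inv //.
  by rewrite unitrN1.
have V1u : V1 \in unitmx by rewrite unitmxE det_ublock det1 mul1r -unitmxE unitmx_inv.
pose U := U1 *m L; pose V := T *m V1.
have Uu : U \in unitmx by rewrite unitmx_mul U1u.
have Vu : V \in unitmx by rewrite unitmx_mul Tu.
have UT : U^T \in unitmx by rewrite unitmx_tr.
have VT : V^T \in unitmx by rewrite unitmx_tr.
have eE0 : U *m E *m V = E0 R r k.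
  rewrite (_ : U *m E *m V = U1 *m (L *m E *m T) *m V1); last by rewrite /U /V !mulmxA.
  rewrite eE /U1 /V1 /E0 !mulmx_block.
  by rewrite !(mulmx0, mul0mx, addr0, add0r, mulmx1, mul1mx).
have eE0T : V^T *m E^T *m U^T = E0 R r k by rewrite -E0_tr -eE0 !trmx_mul mulmxA.
have eA : drsubmx (U *m A *m V) = - pid_mx (\rank a).
  rewrite (_ : U *m A *m V = U1 *m (L *m A *m T) *m V1); last by rewrite /U /V !mulmxA.
  rewrite -[L *m A *m T]submxK -/a /U1 /V1 !mulmx_block block_mxKdr.
  rewrite !(mulmx0, mul0mx, addr0, add0r, mulmx1, mul1mx) mulNmx.
  by rewrite -{2}[a]mulmx_ebase !mulmxA mulVmx // mul1mx mulNmx mulmxK.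
have tr3 (X Y : 'M[R]_(r + k)) : Y^T = Y -> (X *m Y *m X^T)^T = X *m Y *m X^T.
  by move=> sY; rewrite !trmx_mul trmxK sY mulmxA.
have eAT : (U *m A *m V)^T = V^T *m A^T *m U^T by rewrite !trmx_mul mulmxA.
have := stabilizable_finite_transform VT UT df; have := stabilizable_infinite_transform VT UT di.
have := stabilizable_finite_transform Uu Vu sf; have := stabilizable_infinite_transform Uu Vu si.
rewrite eE0 eE0T -eAT => si' sf' di' df'.
have [P [F [gP cP gF cF u]]] :=
  coupled_solutions_normal (tr3 U G sG) (psd_congr U pG) (tr3 V^T W sW) (psd_congr V^T pW)
    (tr3 U S sS) (psd_congr U pS) eA sf' si' df' di'.
clearbody U V.
exists (U^T *m P *m invmx V), (V^T^T *m F *m invmx U^T); split.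
- by apply: (gare_transform Vu); rewrite eE0; move: gP; rewrite trmxK.
- apply/stable_pencilP; move: cP; rewrite -eE0 (closed_loop_transform _ Vu) => -[c1 c2].
  by split; [apply: (stable_finite_transform Vu c1)|apply: (index1_transform Vu c2)].
- apply: (gare_transform UT); rewrite eE0T -eAT !trmxK mulmxDr mulmxDl.
  by move: gF; rewrite !trmxK.
- apply/stable_pencilP; move: cF; rewrite -eE0T eAT (closed_loop_transform _ UT) => -[c1 c2].
  by split; [apply: (stable_finite_transform UT c1)|apply: (index1_transform UT c2)].
(* The product of the two solutions changes by a similarity, so invertibility of [1 + F^T P^T] is
   independent of the coordinates. *)
have -> : (V^T^T *m F *m invmx U^T)^T *m (U^T *m P *m invmx V)^T =
    invmx U *m (F^T *m P^T) *m U.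
  by rewrite !trmx_mul !trmx_inv !trmxK -!mulmxA (mulKVmx VT).
have -> : 1%:M + invmx U *m (F^T *m P^T) *m U = invmx U *m (1%:M + F^T *m P^T) *m U.
  by rewrite mulmxDr mulmxDl mulmx1 mulVmx.
by rewrite !unitmx_mul unitmx_inv Uu u.
Qed.
End Existence.

(** * Port-Hamiltonian systems *)

Section Conversion.
Variable R : realType.
Local Notation C := R[i].
Local Open Scope sesquilinear_scope.

Lemma psd1 n : psd (1%:M : 'M[R]_n).
Proof.
move=> x; rewrite mulmx1 mxE sumr_ge0 // => i _.
by rewrite mxE -expr2 sqr_ge0.
Qed.

Lemma psd_gram n m (B : 'M[R]_(n, m)) : psd (B *m B^T).
Proof. by have := psd_congr B (@psd1 m); rewrite mulmx1. Qed.

Lemma gram_tr n m (B : 'M[R]_(n, m)) : (B *m B^T)^T = B *m B^T.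
Proof. by rewrite trmx_mul trmxK. Qed.

Lemma gram_kerR n m (B : 'M[R]_(n, m)) (y : 'cV[R]_n) : B *m B^T *m y = 0 -> B^T *m y = 0.
Proof.
move=> e; rewrite -[B^T *m y]mul1mx; apply: psd_ker; [exact: trmx1|exact: psd1|].
by rewrite mulmx1 trmx_mul trmxK -!mulmxA [B *m _]mulmxA e mulmx0 mxE.
Qed.

Lemma gram_ker n m (B : 'M[R]_(n, m)) (y : 'cV[C]_n) :
  cmx (B *m B^T) *m y = 0 -> cmx B^T *m y = 0.
Proof.
move=> /cmx_ker[/gram_kerR e1 /gram_kerR e2].
by rewrite (cmx_ReIm y) mulmxDr -scalemxAr -!cmxM e1 e2 cmx0 scaler0 addr0.
Qed.

Lemma strongly_stabilizable_finite n m (E A : 'M[R]_n) (B : 'M[R]_(n, m)) :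
  strongly_stabilizable E A B -> stabilizable_finite E A (B *m B^T).
Proof.
move=> [_ h] l y hl e /gram_ker By.
have rf : row_free (row_mx (l *: cmx E - cmx A) (cmx B)) by rewrite /row_free h.
apply: trmx_inj; apply: (row_free_inj rf).
rewrite trmx0 mul0mx mul_mx_row -row_mx0; congr row_mx; apply: trmx_inj.
  rewrite trmx_mul trmxK trmx0 linearB linearZ /= -!cmx_tr mulmxBl -scalemxAl e subrr //.
by rewrite trmx_mul trmxK trmx0 -cmx_tr.
Qed.

Lemma strongly_stabilizable_infinite n m (E A : 'M[R]_n) (B : 'M[R]_(n, m)) :
  strongly_stabilizable E A B -> stabilizable_infinite E A (B *m B^T).
Proof.
move=> [[k [S [eS rk]]] _] u Eu /gram_kerR Bu h.
have rf : row_free (row_mx E (row_mx (A *m S) B)) by rewrite /row_free rk.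
apply: trmx_inj; apply: (row_free_inj rf).
rewrite trmx0 mul0mx !mul_mx_row -!row_mx0.
have -> : u^T *m E = 0 by apply: trmx_inj; rewrite trmx_mul trmxK trmx0.
have -> : u^T *m B = 0 by apply: trmx_inj; rewrite trmx_mul trmxK trmx0.
congr (row_mx _ (row_mx _ _)).
have ES : E *m S = 0.
  by apply: trmx_inj; rewrite trmx_mul trmx0; apply/sub_kermxP; rewrite eS.
rewrite mulmxA; apply/matrixP=> i j; rewrite ord1 [RHS]mxE.
have := h (col j S); rewrite colE [E *m _]mulmxA ES mul0mx mulmxA -colE => /(_ erefl).
by move/matrixP/(_ 0 0); rewrite [RHS]mxE mxE.
Qed.

Lemma stabilizing_GCE n m (E A : 'M[R]_n) (B : 'M[R]_(n, m)) (C' : 'M[R]_(m, n)) P :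
  stabilizing_GC E A B C' P <->
  gare E A (B *m B^T) (C'^T *m C') P /\ stable_pencil E (A - B *m B^T *m P).
Proof. by rewrite /stabilizing_GC /GC /gare !mulmxA. Qed.

Lemma stabilizing_GFE n m (E A S : 'M[R]_n) (B : 'M[R]_(n, m)) (C' : 'M[R]_(m, n)) P :
  stabilizing_GF E A S B C' P <->
  gare E^T A^T (C'^T *m C') (B *m B^T + 2%:R *: S) P^T /\
  stable_pencil E^T (A^T - C'^T *m C' *m P^T).
Proof.
rewrite /stabilizing_GF /GF /gare !trmxK !mulmxA !addrA.
have -> : A^T - C'^T *m C' *m P^T = (A - P *m C'^T *m C')^T.
  by rewrite trmxB !trmx_mul trmxK !mulmxA.
split=> -[h1 h2]; split; [exact: h1|exact: (stable_pencil_tr _ _).2 h2|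
  exact: h1|exact: (stable_pencil_tr _ _).1 h2].
Qed.

(** With [D = P1 - P2], subtracting the equations gives [(A - G P1)^T D + D^T (A - G P2) = 0]. *)
Lemma gare_unique n (E A G W P1 P2 : 'M[R]_n) : G^T = G ->
    gare E A G W P1 -> gare E A G W P2 ->
    stable_pencil E (A - G *m P1) -> stable_pencil E (A - G *m P2) ->
  E^T *m P1 = E^T *m P2.
Proof.
move=> sG [e1 s1] [e2 s2] h1 h2; apply/eqP; rewrite -subr_eq0 -mulmxBr; apply/eqP.
apply: (descriptor_sylvester0 h1 h2); last by rewrite mulmxBr trmxB mulmxBl s1 s2.
rewrite -[RHS](subrr 0) -[X in _ = X - _]e1 -[X in _ = _ - X]e2 !trmxB trmx_mul sG.
rewrite !(mulmxDl, mulmxDr, mulmxN, mulNmx) !mulmxA; zmod_abel.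
Qed.

Lemma form_trC n (M : 'M[R]_n) (z : 'cV[C]_n) :
  (z^t* *m cmx M *m z)^t* = z^t* *m cmx M^T *m z.
Proof. by rewrite !trmxC_mul trmxCK cmx_trC mulmxA. Qed.

Lemma skew_form n (J : 'M[R]_n) (z : 'cV[R]_n) : J^T = - J -> z^T *m J *m z = 0.
Proof.
move=> hJ; have : z^T *m J *m z = - (z^T *m J *m z).
  by rewrite -[LHS]trmx11 !trmx_mul trmxK hJ mulNmx mulmxN mulmxA.
move/matrixP/(_ 0 0); rewrite [RHS]mxE => h.
by apply/matrixP=> i j; rewrite !ord1 [RHS]mxE; lra.
Qed.

(** * Output feedback of the port-Hamiltonian system and the explicit filter solution *)

Section PortHamiltonian.
Variables (n m : nat) (E J S Q : 'M[R]_n) (B : 'M[R]_(n, m)).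
Hypotheses (hEQ : E^T *m Q = Q^T *m E) (hEQpsd : psd (E^T *m Q)).
Hypotheses (hJ : J^T = - J) (hS : S^T = S) (hSpsd : psd S).
Let A := (J - S) *m Q.
Let K := B^T *m Q.
(** The dissipation matrix after output feedback, which adds [B B^T] to [S]. *)
Let D := S + B *m B^T.

(** [E^T Q] acts as a Lyapunov form: an eigenvector in the closed right half-plane cannot dissipate,
    so its output [K x] vanishes, and detectability excludes it. *)
Lemma port_hamiltonian_output_feedback : 
  strongly_detectable E A K -> stable_pencil E (A - B *m K).
Proof.
move=> det.
have df := strongly_stabilizable_finite det; have di := strongly_stabilizable_infinite det.
have eA : A - B *m K = (J - D) *m Q.
  by rewrite /A /K /D mulmxA -mulmxBl; congr (_ *m _); zmod_abel.
have sD : D^T = D by rewrite trmxD hS gram_tr.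
have pD : psd D := psdD hSpsd (psd_gram B).
have sEQ : (E^T *m Q)^T = E^T *m Q by rewrite trmx_mul trmxK.
apply/stable_pencilP; split.
  move=> l x hl e; have [z ez] : exists z, cmx Q *m x = z by eexists.
  have [q0 _] := psd_complex x sEQ hEQpsd.
  have [t0 tk] := psd_complex z sD pD.
  (* Adding this identity to its conjugate cancels the skew part [J] and leaves minus twice the
     dissipation. *)
  have f1 : l *: (x^t* *m cmx (E^T *m Q) *m x) = z^t* *m cmx J *m z - z^t* *m cmx D *m z.
    have -> : x^t* *m cmx (E^T *m Q) *m x = z^t* *m (cmx E *m x).
      by rewrite hEQ cmxM -ez trmxC_mul cmx_trC !mulmxA.
    by rewrite scalemxAr -e eA cmxM cmxB -mulmxA ez mulmxBl mulmxBr !mulmxA.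
  have f2 : l^* *: (x^t* *m cmx (E^T *m Q) *m x) = - (z^t* *m cmx J *m z) - z^t* *m cmx D *m z.
    have := congr1 (fun M => M^t*) f1; rewrite trmxCZ trmxCB !form_trC sEQ sD hJ => ->.
    by rewrite cmxN mulmxN mulNmx.
  have Dz : cmx D *m z = 0.
    apply: tk; have : (l + l^*) * (x^t* *m cmx (E^T *m Q) *m x) 0 0 = - (z^t* *m cmx D *m z) 0 0 *+ 2.
      have : (l + l^*) *: (x^t* *m cmx (E^T *m Q) *m x) = - (z^t* *m cmx D *m z) *+ 2.
        by rewrite scalerDl f1 f2 mulr2n; zmod_abel.
      by move/matrixP/(_ 0 0); rewrite !mxE.
    have ll : 0 <= l + l^* by rewrite [l + l^*]addcJ mulr_ge0 // ler0c.
    move=> h; have := mulr_ge0 ll q0; rewrite h mulNrn oppr_ge0 pmulrn_lle0 // => t1.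
    by apply/eqP; rewrite eq_le t1 t0.
  have Kx : cmx K *m x = 0.
    rewrite /K cmxM -mulmxA ez; apply: gram_ker.
    by apply: (psdD_ker (gram_tr B) (psd_gram B) hS hSpsd); rewrite addrC; exact: Dz.
  apply: (df l) => //; rewrite !trmxK; last by rewrite cmxM -mulmxA Kx mulmx0.
  by rewrite -e cmxB mulmxBl cmxM -mulmxA Kx mulmx0 subr0.
move=> x w Ex e; set z := Q *m x.
(* On the kernel of [E] the vector [Q x] is orthogonal to the image of [E], so the dissipation
   vanishes without any eigenvalue. *)
have zQ : z^T *m E = 0.
  by rewrite trmx_mul -mulmxA -hEQ mulmxA -trmx_mul Ex trmx0 mul0mx.
have zJ := skew_form z hJ.
have Dz : D *m z = 0.
  apply: psd_ker => //.
  have : z^T *m ((J - D) *m Q *m x) = 0 by rewrite -eA e mulmxA zQ mul0mx.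
  rewrite -mulmxA -/z mulmxA mulmxBr mulmxBl zJ sub0r => /eqP.
  by rewrite oppr_eq0 => /eqP->; rewrite mxE.
have Kx : K *m x = 0.
  rewrite /K -mulmxA -/z; apply: gram_kerR.
  by apply: (psdD_kerR (gram_tr B) (psd_gram B) hS hSpsd); rewrite addrC; exact: Dz.
apply: di; rewrite ?trmxK //; first by rewrite -mulmxA Kx mulmx0.
have Ax : A *m x = E *m w by rewrite -e mulmxBl -(mulmxA B) Kx mulmx0 subr0.
move=> v Ev; rewrite -trmx_mul Ax.
by rewrite trmx_mul -mulmxA Ev mulmx0.
Qed.

(** For this [Pf] one has [Pf K^T = B], so the filter closed loop is the output feedback [A - B K],
    and the equation reduces to the cancellation of [J] with its transpose. *)
Lemma port_hamiltonian_GF_solution : Q \in unitmx -> strongly_detectable E A K ->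
  stabilizing_GF E A S B K (invmx Q^T).
Proof.
move=> Qu det.
have QT : Q^T \in unitmx by rewrite unitmx_tr.
have eK : invmx Q^T *m K^T = B by rewrite /K trmx_mul trmxK mulKmx.
have eP : (invmx Q^T)^T = invmx Q by rewrite trmx_inv trmxK.
split; last by rewrite eK; exact: port_hamiltonian_output_feedback.
split.
  rewrite eK eP /A trmx_mul mulmxK // mulKmx // /K -!mulmxA mulmxV // mulmx1.
  by rewrite trmxB hJ hS scaler_nat mulr2n; zmod_abel.
rewrite eP; apply: (can_inj (mulKmx QT)); apply: (can_inj (mulmxK Qu)).
by rewrite -!mulmxA mulVmx // mulmx1 mulKVmx // hEQ.
Qed.
End PortHamiltonian.
End Conversion.

Theorem mainTheorem3 (R : realType) (n m : nat)
  (E J Rm Q : 'M[R]_n) (B : 'M[R]_(n, m))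
  (hEQ : E^T *m Q = Q^T *m E) (hEQpsd : psd (E^T *m Q))
  (hJ : J^T = - J) (hR : Rm^T = Rm) (hRpsd : psd Rm) :
  let A := (J - Rm) *m Q in
  let C := B^T *m Q in
  regular_pencil E A ->
  strongly_stabilizable E A B ->
  strongly_detectable E A C ->
  [/\ (* (i) *)
      (exists Pc, stabilizing_GC E A B C Pc) /\ (exists Pf, stabilizing_GF E A Rm B C Pf),
      (* (ii) *)
      (forall Pc1 Pc2, stabilizing_GC E A B C Pc1 -> stabilizing_GC E A B C Pc2 ->
         E^T *m Pc1 = E^T *m Pc2) /\
      (forall Pf1 Pf2, stabilizing_GF E A Rm B C Pf1 -> stabilizing_GF E A Rm B C Pf2 ->
         E *m Pf1^T = E *m Pf2^T),
      (* (iii) *)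
      (Q \in unitmx -> stabilizing_GF E A Rm B C (invmx (Q^T))) &
      (* (iv) *)
      exists Pc Pf, [/\ stabilizing_GC E A B C Pc, stabilizing_GF E A Rm B C Pf &
                        (1%:M + Pf *m Pc^T) \in unitmx]].
Proof.
move=> A C _ stab det.
have sG := gram_tr B; have pG := psd_gram B.
have := gram_tr C^T; rewrite trmxK => sW; have := psd_gram C^T; rewrite trmxK => pW.
have sS : (2%:R *: Rm)^T = 2%:R *: Rm by rewrite linearZ /= hR.
have pS : psd (2%:R *: Rm).
  by move=> x; rewrite scaler_nat mulr2n; apply: psdD.
have df := strongly_stabilizable_finite det; have di := strongly_stabilizable_infinite det.
rewrite trmxK in df di.
(* The abstract result is used with [G = B B^T], [W = C^T C] and [S = 2 Rm]; its second solution is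
   the transpose of the filter solution. *)
have [P [F [gP cP gF cF u]]] := coupled_solutions sG pG sW pW sS pS
  (strongly_stabilizable_finite stab) (strongly_stabilizable_infinite stab) df di.
have sP : stabilizing_GC E A B C P by apply/stabilizing_GCE.
have sF : stabilizing_GF E A Rm B C F^T by apply/stabilizing_GFE; rewrite trmxK.
split.
- by split; [exists P|exists F^T].
- split=> [P1 P2 /stabilizing_GCE[g1 h1] /stabilizing_GCE[g2 h2]|
           P1 P2 /stabilizing_GFE[g1 h1] /stabilizing_GFE[g2 h2]].
    exact: (gare_unique sG g1 g2 h1 h2).
  by have := gare_unique sW g1 g2 h1 h2; rewrite trmxK.
- by move=> Qu; apply: port_hamiltonian_GF_solution.
by exists P, F^T.
Qed.
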